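(* Let $\mathbb{G}$ be a compact quantum group and let $I\subseteq L^1(\mathbb{G})$ be a left ideal. Then there is a hull $E=(E_\pi)_{\pi\in Irr(\mathbb{G})}$ such that $j(E)\subseteq I\subseteq I(E)$.
   Context: A compact quantum group (CQG) $\mathbb{G}$ is a locally compact quantum group in the sense of Kustermans and Vaes whose $C^*$-algebras are unital. It has a von Neumann algebra $L^\infty(\mathbb{G})$, a coproduct $\Delta_{\mathbb{G}}:L^\infty(\mathbb{G})\to L^\infty(\mathbb{G})\overline{\otimes}L^\infty(\mathbb{G})$ and a normal faithful Haar state $h_{\mathbb{G}}$. The predual $L^1(\mathbb{G})=L^\infty(\mathbb{G})_*$ is a Banach algebra under convolution $f*g=(f\otimes g)\Delta_{\mathbb{G}}$. $Irr(\mathbb{G})$ is a family containing one representative $\pi:L^1(\mathbb{G})\to\mathcal{B}(\mathcal{H}_\pi)$ of each unitary equivalence class of irreducible $*$-representations of $L^1(\mathbb{G})$ (those corresponding to unitary irreducible co-representations). Each $\mathcal{H}_\pi$ is finite dimensional, of dimension $n_\pi$, and $\pi(f)=(f\otimes\mathrm{id})(U^\pi)$ for a unitary $U^\pi=[u^\pi_{i,j}]\in L^\infty(\mathbb{G})\otimes M_{n_\pi}$ with $\Delta_{\mathbb{G}}(u^\pi_{i,j})=\sum_t u^\pi_{i,t}\otimes u^\pi_{t,j}$. $\mathrm{Pol}(\mathbb{G})$ is the linear span of all $u^\pi_{i,j}$. For $x\in L^\infty(\mathbb{G})$, $\widehat{x}\in L^1(\mathbb{G})$ is $\widehat{x}(y)=h_{\mathbb{G}}(xy)$,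 and $\widehat{\mathrm{Pol}(\mathbb{G})}=\{\widehat{x}:x\in \mathrm{Pol}(\mathbb{G})\}$ (equivalently, the $f\in L^1(\mathbb{G})$ with $\pi(f)=0$ for all but finitely many $\pi\in Irr(\mathbb{G})$). A hull is a family $E=(E_\pi)_{\pi\in Irr(\mathbb{G})}$ of linear subspaces $E_\pi\subseteq\mathcal{H}_\pi$ (possibly $\{0\}$ or $\mathcal{H}_\pi$). Put $I(E)=\{f\in L^1(\mathbb{G}):\pi(f)(E_\pi)=0\text{ for all }\pi\in Irr(\mathbb{G})\}$ and $j(E)=I(E)\cap\widehat{\mathrm{Pol}(\mathbb{G})}$. *)

(* Defs.v *)
From HB Require Import structures.
From mathcomp Require Import all_boot all_order all_algebra.
From mathcomp Require Import complex.
From mathcomp Require Import all_classical all_reals all_analysis.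

Set Implicit Arguments.
Unset Strict Implicit.
Unset Printing Implicit Defensive.

Import Order.TTheory GRing.Theory Num.Theory.
Import numFieldNormedType.Exports.

Local Open Scope classical_set_scope.
Local Open Scope ring_scope.

(* Inner products are linear in the first variable. *)
Record hilbertSpace (R : realType) := HilbertSpace {
  hs_space :> completeNormedModType R[i];
  hs_dot : {dot hs_space for Num.conj};
  hs_normE : forall x : hs_space, `|x| ^+ 2 = hs_dot x x
}.

Definition bounded_op (R : realType) (H : hilbertSpace R) (T : H -> H) :=
  linear T /\ continuous T.

Definition commutant (R : realType) (H : hilbertSpace R) (S : set (H -> H)) :
    set (H -> H) :=
  [set T | bounded_op T /\ forall U, S U -> T \o U = U \o T].

(* A von Neumann algebra acting on a Hilbert space: a unital complex algebra
   with involution, together with a faithful unital *-representation [vn_op] by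
   bounded operators whose range is its own bicommutant.  The elements of the
   algebra are thus those of the concrete von Neumann algebra [range vn_op]. *)
Record vnAlgebra (R : realType) := VNAlgebra {
  vn_sort :> algType R[i];
  vn_star : vn_sort -> vn_sort;
  vn_space : hilbertSpace R;
  vn_op : vn_sort -> vn_space -> vn_space;
  vn_op_bounded : forall a, bounded_op (vn_op a);
  vn_op_linear : forall (c : R[i]) a b v,
    vn_op (c *: a + b) v = c *: vn_op a v + vn_op b v;
  vn_op1 : vn_op 1 = id;
  vn_opM : forall a b, vn_op (a * b) = vn_op a \o vn_op b;
  vn_op_star : forall a v w,
    hs_dot vn_space (vn_op a v) w = hs_dot vn_space v (vn_op (vn_star a) w);
  vn_op_inj : injective vn_op;
  vn_bicommutant : commutant (commutant (range vn_op)) = range vn_op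
}.

(* The normal (sigma-weakly continuous) linear functionals: those of the form
   x |-> sum_n <x xi_n, eta_n> with square-summable sequences of vectors. *)
Definition predual (R : realType) (M : vnAlgebra R) : set (M -> R[i]) :=
  [set f | exists xi eta : nat -> vn_space M,
    [/\ cvgn (series (fun n => `|xi n| ^+ 2)),
        cvgn (series (fun n => `|eta n| ^+ 2)) &
        forall x : M,
          (series (fun n => hs_dot (vn_space M) (vn_op x (xi n)) (eta n))
             : nat -> R[i]^o) @ \oo --> (f x : R[i]^o)]].

Definition normal_star_morphism (R : realType) (M N : vnAlgebra R)
    (Phi : {lrmorphism M -> N}) : Prop :=
  (forall x, Phi (vn_star x) = vn_star (Phi x)) /\
  (forall f, predual f -> predual (f \o Phi)).

(* The von Neumann algebra tensor product of M and N, acting on the Hilbert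
   tensor product of their Hilbert spaces; both are pinned down up to a
   canonical isomorphism by these fields. *)
Record vnTensor (R : realType) (M N : vnAlgebra R) := VNTensor {
  vt_alg :> vnAlgebra R;
  vt_vec : {bilinear vn_space M -> vn_space N -> vn_space vt_alg};
  vt_vec_dot : forall v w v' w',
    hs_dot (vn_space vt_alg) (vt_vec v w) (vt_vec v' w') =
    hs_dot (vn_space M) v v' * hs_dot (vn_space N) w w';
  vt_vec_dense : dense
    (range (fun s : seq (vn_space M * vn_space N) =>
              \sum_(p <- s) vt_vec p.1 p.2));
  vt_tens : M -> N -> vt_alg;
  vt_tensE : forall a b v w,
    vn_op (vt_tens a b) (vt_vec v w) = vt_vec (vn_op a v) (vn_op b w);
  vt_generated : range (@vn_op R vt_alg) =
    commutant (commutant [set vn_op (vt_tens ab.1 ab.2) | ab in [set: M * N]])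
}.

(* F = f \otimes g.  F is unique, elementary tensors being sigma-weakly total. *)
Definition tensor_functional (R : realType) (M N : vnAlgebra R)
    (T : vnTensor M N) (f : M -> R[i]) (g : N -> R[i]) (F : T -> R[i]) : Prop :=
  predual F /\ forall a b, F (vt_tens T a b) = f a * g b.

(* (Delta \otimes id) Delta = (id \otimes Delta) Delta, the two triple tensor
   products being identified by the associativity isomorphism [assoc]. *)
Definition coassociative (R : realType) (M : vnAlgebra R) (T : vnTensor M M)
    (Delta : {lrmorphism M -> T}) : Prop :=
  exists (Tl : vnTensor T M) (Tr : vnTensor M T)
    (Delta_id : {lrmorphism T -> Tl}) (id_Delta : {lrmorphism T -> Tr})
    (assoc : {lrmorphism Tl -> Tr}),
    [/\ normal_star_morphism Delta_id /\
          (forall a b, Delta_id (vt_tens T a b) = vt_tens Tl (Delta a) b),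
        normal_star_morphism id_Delta /\
          (forall a b, id_Delta (vt_tens T a b) = vt_tens Tr a (Delta b)),
        normal_star_morphism assoc /\
          (forall a b c, assoc (vt_tens Tl (vt_tens T a b) c) =
                         vt_tens Tr a (vt_tens T b c)) &
        forall x, assoc (Delta_id (Delta x)) = id_Delta (Delta x)].

(* A locally compact quantum group in von Neumann algebraic form is compact
   exactly when its Haar weight is finite; normalised, it is then a state and
   is both left and right invariant. *)
Record compactQuantumGroup (R : realType) := CompactQuantumGroup {
  Linfty :> vnAlgebra R;
  Linfty2 : vnTensor Linfty Linfty;
  coproduct : {lrmorphism Linfty -> Linfty2};
  coproduct_normal : normal_star_morphism coproduct;
  coproduct_assoc : coassociative coproduct;
  haar : Linfty -> R[i];
  haar_normal : predual haar;
  haar1 : haar 1 = 1;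
  haar_ge0 : forall x, 0 <= haar (vn_star x * x);
  haar_faithful : forall x, haar (vn_star x * x) = 0 -> x = 0;
  (* h((f \otimes id) Delta x) = f(1) h(x) = h((id \otimes f) Delta x) *)
  haar_left : forall f (F : Linfty2 -> R[i]), predual f ->
    tensor_functional f haar F -> forall x, F (coproduct x) = f 1 * haar x;
  haar_right : forall f (F : Linfty2 -> R[i]), predual f ->
    tensor_functional haar f F -> forall x, F (coproduct x) = f 1 * haar x
}.

Section CompactQuantumGroup.
Variables (R : realType) (G : compactQuantumGroup R).

Definition L1 : set (G -> R[i]) := @predual R G.

(* k = f * g = (f \otimes g) Delta. *)
Definition convolution (f g k : G -> R[i]) : Prop :=
  exists F : Linfty2 G -> R[i],
    tensor_functional f g F /\ forall x, k x = F (coproduct G x).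

(* Not assumed to be closed. *)
Definition left_ideal (I : set (G -> R[i])) : Prop :=
  [/\ I `<=` L1,
      I (fun=> 0),
      forall (c : R[i]) f g, I f -> I g -> I (fun x => c * f x + g x) &
      forall f g k, L1 f -> I g -> convolution f g k -> I k].

Definition mx_star n (U : 'M[G]_n) : 'M[G]_n := (map_mx (@vn_star R G) U)^T.

Definition unitary_corep n (U : 'M[G]_n) : Prop :=
  [/\ U *m mx_star U = 1%:M,
      mx_star U *m U = 1%:M &
      forall i j, coproduct G (U i j) =
                  \sum_t vt_tens (Linfty2 G) (U i t) (U t j)].

(* The representation f |-> (f \otimes id) U of L1 on column vectors. *)
Definition rep_of n (U : 'M[G]_n) (f : G -> R[i]) : 'M[R[i]]_n := map_mx f U.

Definition irreducible_corep n (U : 'M[G]_n) : Prop :=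
  (0 < n)%N /\
  forall V : {vspace 'cV[R[i]]_n},
    (forall f v, L1 f -> v \in V -> rep_of U f *m v \in V) ->
    V = 0%VS \/ V = fullv.

Definition unitarily_equivalent m n (U : 'M[G]_m) (V : 'M[G]_n) : Prop :=
  exists T : 'M[R[i]]_(n, m),
    [/\ T *m (map_mx Num.conj T)^T = 1%:M,
        (map_mx Num.conj T)^T *m T = 1%:M &
        forall f, L1 f -> T *m rep_of U f = rep_of V f *m T].

(* Irr(G): one representative of each class of irreducible unitary
   co-representations; H_pi is the space of columns of height [irr_dim pi]. *)
Record irrFamily := IrrFamily {
  irr_index :> Type;
  irr_dim : irr_index -> nat;
  irr_coef : forall p, 'M[G]_(irr_dim p);
  irr_unitary : forall p, unitary_corep (irr_coef p);
  irr_irreducible : forall p, irreducible_corep (irr_coef p);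
  irr_distinct : forall p q,
    unitarily_equivalent (irr_coef p) (irr_coef q) -> p = q;
  irr_complete : forall n (U : 'M[G]_n),
    unitary_corep U -> irreducible_corep U ->
    exists p, unitarily_equivalent U (irr_coef p)
}.

Variable Irr : irrFamily.

Definition Pol : set G :=
  [set x | exists s : seq (R[i] * {p : Irr & 'I_(irr_dim p) * 'I_(irr_dim p)}%type),
    x = \sum_(a <- s)
          a.1 *: irr_coef (tag a.2) (tagged a.2).1 (tagged a.2).2].

Definition hat (x : G) : G -> R[i] := fun y => haar (x * y).

Definition hull := forall p : Irr, {vspace 'cV[R[i]]_(irr_dim p)}.

Definition hull_I (E : hull) : set (G -> R[i]) :=
  [set f | L1 f /\ forall p v, v \in E p -> rep_of (irr_coef p) f *m v = 0].

Definition hull_j (E : hull) : set (G -> R[i]) :=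
  hull_I E `&` [set hat x | x in Pol].

End CompactQuantumGroup.

(* Main.v *)
From HB Require Import structures.
Require Import Defs.
From mathcomp Require Import all_boot all_order all_algebra.
From mathcomp Require Import complex ring zify.
From mathcomp Require Import all_classical all_reals all_analysis.

(* With Ubar the entrywise adjoint of U = irr_coef p, the Haar state yields a
   positive definite matrix Q such that B = Q Ubar Q^-1 is inverse to U^T; it is
   similar to an irreducible representation of the family.  Strong invariance of
   the Haar state then gives the finite formula
     hat (U i j) * g = \sum_k g (B j k) hat (U i k),
   so that, for g in a left ideal I, the rows of g(B) span rows w such that
   hat (\sum_k w_k U i k) belongs to I, for all i.  Take for E the common
   kernels of I.  If f = hat x belongs to I(E), then f(B) kills every vector
   killed by all g(B), g in I.  As the Haar state pairs the entries of U with
   those of B by a nondegenerate matrix times the identity, and annihilates the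
   other irreducible co-representations, f(B) v = 0 forces the coefficient
   matrix of x at p to kill v: the rows of that matrix are in the span above. *)

Set Implicit Arguments.
Unset Strict Implicit.
Unset Printing Implicit Defensive.

Import Order.TTheory GRing.Theory Num.Theory.
Import numFieldNormedType.Exports.

Local Open Scope classical_set_scope.
Local Open Scope ring_scope.

(** * Limits and series of complex numbers *)

(** [K^o] is the field as a normed module over itself, where the limit lemmas live; the wrapper
    keeps it out of later statements. *)
Definition seq_lim (K : numFieldType) (u : nat -> K) (l : K) : Prop :=
  (u : nat -> K^o) @ \oo --> (l : K^o).

Section SequenceLimits.
Variable K : numFieldType.
Implicit Types (u v : nat -> K) (a b : K).

Lemma seq_limP u a :
  seq_lim u a <-> forall e, 0 < e -> \forall n \near \oo, `|a - u n| < e.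
Proof. exact: (@cvgrPdist_lt K K^o). Qed.

Lemma seq_limD u v a b : seq_lim u a -> seq_lim v b ->
  seq_lim (fun n => u n + v n) (a + b).
Proof. exact: (@cvgD K K^o). Qed.

Lemma seq_limM u v a b : seq_lim u a -> seq_lim v b ->
  seq_lim (fun n => u n * v n) (a * b).
Proof. exact: (@cvgM K). Qed.

Lemma seq_lim_cst a : seq_lim (fun=> a) a.
Proof. exact: (@cvg_cst K^o). Qed.

Lemma seq_lim_unique u a b : seq_lim u a -> seq_lim u b -> a = b.
Proof. exact: (@cvg_unique K^o). Qed.

Lemma seq_lim_sub u a (g : nat -> nat) : (forall n, (n <= g n)%N) ->
  seq_lim u a -> seq_lim (u \o g) a.
Proof.
move=> gn ua; apply: cvg_comp ua => A [N _ NA]; exists N => // n /= Nn.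
by apply: NA => /=; apply: leq_trans (gn n).
Qed.

Lemma seq_lim_bounded u a : seq_lim u a ->
  exists2 M, 0 <= M & forall n, `|u n| <= M.
Proof.
move=> ua; have /(@cvg_seq_bounded K K^o)/pinfty_ex_gt0[M M0 uM] :
  cvgn (u : nat -> K^o) by apply/cvg_ex; exists a.
by exists M => [|n]; [exact: ltW | exact: uM].
Qed.

End SequenceLimits.

Section ComplexSeries.
Variable R : realType.

Lemma cvg_real_complex (a : nat -> R) (l : R) :
  a @ \oo --> l -> seq_lim (fun n => (a n)%:C%C) l%:C%C.
Proof.
move=> al; apply/seq_limP => e e0.
(* A positive complex number is real, so [e] is the image of its real part. *)
have eE : (complex.Re e)%:C%C = e by rewrite RRe_real // gtr0_real.
have re0 : 0 < complex.Re e by rewrite -ltcR eE.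
move/cvgrPdist_lt : al => /(_ _ re0) al.
near=> n.
have : `|l - a n| < complex.Re e by near: n; exact: al.
by rewrite -ltcR eE -rmorphB normc_def /= expr0n addr0 sqrtr_sqr.
Unshelve. all: by end_near. Qed.

Lemma abs_series_cvg_real (a : nat -> R) (M : R) :
  (forall n, \sum_(0 <= k < n) `|a k| <= M) -> cvgn (series a).
Proof.
move=> aM; apply: normed_cvg; apply: nondecreasing_is_cvgn.
  by apply: nondecreasing_series => n _ _ /=; apply: normr_ge0.
by exists M => _ [n _ <-]; exact: aM.
Qed.

(** Real and imaginary parts are bounded by the modulus, so both of their series converge absolutely
    over the reals. *)
Lemma abs_series_cvg (z : nat -> R[i]) (M : R[i]) :
  (forall n, \sum_(0 <= k < n) `|z k| <= M) ->
  exists l : R[i], seq_lim (series z) l.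
Proof.
move=> zM.
have partM (f : R[i] -> R) : (forall w, `|f w|%:C%C <= `|w|) ->
    cvgn (series (fun k => f (z k))).
  move=> fle; apply: (@abs_series_cvg_real _ (complex.Re M)) => n.
  have M0 : 0 <= M by apply: le_trans (zM 0%N); rewrite big_geq.
  rewrite -lecR RRe_real ?ger0_real // (le_trans _ (zM n)) //.
  by rewrite rmorph_sum /=; apply: ler_sum => k _; exact: fle.
have /cvg_ex[a /cvg_real_complex ha] := partM (@complex.Re R) (@normc_ge_Re _).
have /cvg_ex[b /cvg_real_complex hb] : cvgn (series (fun k => complex.Im (z k))).
  apply: partM => w; rewrite normc_def lecR -sqrtr_sqr ler_wsqrtr //.
  by rewrite lerDr sqr_ge0.
exists (a%:C%C + 'i%C * b%:C%C).
rewrite (_ : series z = (fun n => (series (fun k => complex.Re (z k)) n)%:C%C +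
  'i%C * (series (fun k => complex.Im (z k)) n)%:C%C)).
  exact: (seq_limD ha (seq_limM (@seq_lim_cst R[i] 'i%C) hb)).
apply/funext => n; rewrite /series /= !rmorph_sum /= mulr_sumr -big_split /=.
by apply: eq_bigr => k _; exact: complexE.
Qed.

End ComplexSeries.

Section Predual.
Variable R : realType.

(** For nonnegative terms, bounded partial sums amount to convergence, and a bound is easier to
    carry over to tensor products. *)
Definition square_summable (H : hilbertSpace R) (xi : nat -> H) : Prop :=
  exists2 M : R[i], 0 <= M & forall n, \sum_(0 <= k < n) `|xi k| ^+ 2 <= M.

Lemma predualP (M : vnAlgebra R) (f : M -> R[i]) :
  predual f <-> exists xi eta : nat -> vn_space M,
    [/\ square_summable xi, square_summable eta & forall x,
      seq_lim (series (fun n => hs_dot (vn_space M) (vn_op x (xi n)) (eta n))) (f x)].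
Proof.
have sqP (xi : nat -> vn_space M) :
    square_summable xi <-> cvgn (series (fun n => `|xi n| ^+ 2)).
  have pos n : 0 <= \sum_(0 <= k < n) `|xi k| ^+ 2.
    by apply: sumr_ge0 => k _; rewrite exprn_ge0.
  split=> [[N _ xiN]|/cvg_ex[l /seq_lim_bounded[N N0 xiN]]].
    apply/cvg_ex.
    have [|l] := @abs_series_cvg _ (fun n => `|xi n| ^+ 2) N; last by exists l.
    by move=> n; under eq_bigr do rewrite ger0_norm ?exprn_ge0 //.
  by exists N => // n; have := xiN n; rewrite /series /= ger0_norm ?pos.
by split=> -[xi [eta [/sqP ? /sqP ? ?]]]; exists xi, eta.
Qed.

End Predual.

(** * Hilbert spaces and von Neumann algebras *)

Section HilbertSpace.
Variables (R : realType) (H : hilbertSpace R).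
Implicit Types (u v w : H) (c : R[i]).
Local Notation "''[' v , w ]" := (hs_dot H v w).

Lemma hs_dotC v w : '[v, w] = Num.conj '[w, v].
Proof. by rewrite hermC expr0 mul1r. Qed.

Lemma hs_dotDl u v w : '[u + v, w] = '[u, w] + '[v, w].
Proof. exact: linearDl. Qed.

Lemma hs_dotZl c v w : '[c *: v, w] = c * '[v, w].
Proof. exact: linearZl_LR. Qed.

Lemma hs_dotDr u v w : '[u, v + w] = '[u, v] + '[u, w].
Proof. exact: linearDr. Qed.

Lemma hs_dotZr c v w : '[v, c *: w] = Num.conj c * '[v, w].
Proof. exact: linearZr_LR. Qed.

Lemma hs_dot0l v : '[0, v] = 0.
Proof. exact: linear0l. Qed.

Lemma hs_dot_inj v w : (forall u, '[v, u] = '[w, u]) -> v = w.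
Proof.
move=> vw; apply/eqP; rewrite -subr_eq0 -normr_eq0 -sqrf_eq0 hs_normE.
by rewrite hs_dotDl vw -hs_dotDl subrr hs_dot0l.
Qed.

(** A weak form of Cauchy-Schwarz, enough for absolute convergence: expand the square of the norm of
    [v - c *: w], where [c] is the phase of the inner product. *)
Lemma norm_hs_dot v w : `|'[v, w]| <= `|v| ^+ 2 + `|w| ^+ 2.
Proof.
set d := '[v, w]; pose c := if d == 0 then 1 else d / `|d|.
have c1 : `|c| = 1.
  rewrite /c; case: eqVneq => [_|d0]; first exact: normr1.
  by rewrite normrM normrV ?unitfE ?normr_eq0 // normr_id mulfV ?normr_eq0.
have cd : Num.conj c * d = `|d|.
  rewrite /c; case: eqVneq => [->|d0]; first by rewrite mulr0 normr0.
  rewrite rmorphM fmorphV /= (geC0_conj (normr_ge0 d)) mulrAC.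
  by rewrite (mulrC _ d) -normCK expr2 mulfK ?normr_eq0.
have : 0 <= `|v - c *: w| ^+ 2 by rewrite exprn_ge0.
rewrite hs_normE dnormB -!hs_normE hs_dotZr -/d cd normrZ c1 mul1r.
rewrite (geC0_conj (normr_ge0 d)) subr_ge0 => /(le_trans _); apply.
by rewrite lerDl.
Qed.

Lemma bounded_op_bound (T : H -> H) : bounded_op T ->
  exists2 C : R[i], 0 <= C & forall v, `|T v| <= C * `|v|.
Proof.
move=> [Tlin Tcont].
pose T' : {linear H -> H} := HB.pack T (GRing.isLinear.Build _ _ _ _ T Tlin).
have /linear_boundedP/pinfty_ex_gt0[C C0 TC] := (linear_bounded_continuous T').2 Tcont.
by exists C => //; exact: ltW.
Qed.

Lemma dense_bounded_op_eq (T T' : H -> H) (D : set H) :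
  bounded_op T -> bounded_op T' -> dense D ->
  (forall v, D v -> T v = T' v) -> T = T'.
Proof.
move=> bT bT' dD TT'; apply/funext => v.
have [C C0 TC] := bounded_op_bound bT; have [C' C'0 TC'] := bounded_op_bound bT'.
have subT (S : H -> H) : bounded_op S -> forall x y, S (x - y) = S x - S y.
  move=> [Slin _] x y; have := Slin (-1) y x.
  by rewrite !scaleN1r ![- _ + _]addrC.
apply/eqP; rewrite -subr_eq0 -normr_le0; apply/ler_addgt0Pr => e e0; rewrite add0r.
(* The added 1 keeps the divisor positive when both bounds vanish. *)
have k0 : 0 < C + C' + 1 by rewrite ltr_wpDl // addr_ge0.
have d0 : 0 < e / (C + C' + 1) by rewrite divr_gt0.
have [|s [vs Ds]] := dD _ _ (ball_open v (e / (C + C' + 1))).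
  by exists v; exact: ballxx.
have -> : T v - T' v = T (v - s) - T' (v - s).
  by rewrite (subT T bT) (subT _ bT') (TT' s) // opprB addrA subrK.
rewrite (le_trans (ler_normB _ _)) // (le_trans (lerD (TC _) (TC' _))) //.
rewrite -mulrDl (@le_trans _ _ ((C + C' + 1) * (e / (C + C' + 1)))) //; last first.
  by rewrite mulrC divfK // gt_eqF.
by rewrite ler_pM ?addr_ge0 ?lerDl //; move: vs; rewrite -ball_normE => /ltW.
Qed.

End HilbertSpace.

Section VnAlgebra.
Variables (R : realType) (M : vnAlgebra R).
Implicit Types (a b : M) (c : R[i]).
Local Notation "''[' v , w ]" := (hs_dot (vn_space M) v w).
Local Notation star := (@vn_star _ _).

(** Faithfulness of [vn_op] reduces equality to matrix coefficients; the laws of the involution are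
    derived in this way. *)
Lemma vn_ext a b : (forall v w, '[vn_op a v, w] = '[vn_op b v, w]) -> a = b.
Proof.
by move=> ab; apply: vn_op_inj; apply/funext => v; apply: hs_dot_inj => w.
Qed.

Lemma vn_opD a b v : vn_op (a + b) v = vn_op a v + vn_op b v.
Proof. by rewrite -[a]scale1r vn_op_linear !scale1r. Qed.

Lemma vn_op0 v : vn_op (0 : M) v = 0.
Proof. by apply: (addIr (vn_op (0 : M) v)); rewrite -vn_opD !add0r. Qed.

Lemma vn_opZ c a v : vn_op (c *: a) v = c *: vn_op a v.
Proof. by rewrite -[c *: a]addr0 vn_op_linear vn_op0 addr0. Qed.

Lemma vn_opMv a b v : vn_op (a * b) v = vn_op a (vn_op b v).
Proof. by rewrite vn_opM. Qed.

Lemma vn_starP a v w : '[vn_op (star a) v, w] = '[v, vn_op a w].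
Proof. by rewrite hs_dotC -vn_op_star -hs_dotC. Qed.

Lemma vn_starK : involutive (@vn_star R M).
Proof. by move=> a; apply: vn_ext => v w; rewrite vn_starP -vn_op_star. Qed.

Lemma vn_starD a b : star (a + b) = star a + star b.
Proof.
by apply: vn_ext => v w; rewrite vn_starP !vn_opD hs_dotDr hs_dotDl !vn_starP.
Qed.

Lemma vn_starZ c a : star (c *: a) = Num.conj c *: star a.
Proof.
by apply: vn_ext => v w; rewrite vn_starP !vn_opZ hs_dotZr hs_dotZl vn_starP.
Qed.

Lemma vn_star0 : star (0 : M) = 0.
Proof. by rewrite -(scale0r 0) vn_starZ rmorph0 !scale0r. Qed.

Lemma vn_star1 : star (1 : M) = 1.
Proof. by apply: vn_ext => v w; rewrite vn_starP !vn_op1. Qed.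

Lemma vn_starM a b : star (a * b) = star b * star a.
Proof. by apply: vn_ext => v w; rewrite vn_starP !vn_opMv !vn_starP. Qed.

Lemma vn_star_sum (I : Type) (r : seq I) (F : I -> M) :
  star (\sum_(i <- r) F i) = \sum_(i <- r) star (F i).
Proof.
elim: r => [|i r IHr]; first by rewrite !big_nil vn_star0.
by rewrite !big_cons vn_starD IHr.
Qed.

End VnAlgebra.

(** * Tensor products of von Neumann algebras *)

Section VnTensor.
Variables (R : realType) (M N : vnAlgebra R) (T : vnTensor M N).
Local Notation "a '[x]' b" := (vt_tens T a b) (at level 40).

(** Bounded operators are continuous, and the sums of simple tensors are dense. *)
Lemma vt_ext (x y : T) :
  (forall v w, vn_op x (vt_vec T v w) = vn_op y (vt_vec T v w)) -> x = y.
Proof.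
move=> xy; apply: vn_op_inj.
apply: (dense_bounded_op_eq (vn_op_bounded x) (vn_op_bounded y)
  (@vt_vec_dense _ _ _ T)).
have opS z (s : seq (vn_space M * vn_space N)) :
    vn_op z (\sum_(p <- s) vt_vec T p.1 p.2) = \sum_(p <- s) vn_op z (vt_vec T p.1 p.2).
  have [zlin _] := vn_op_bounded z.
  elim: s => [|p s IHs]; last first.
    by rewrite !big_cons -IHs -[vt_vec T _ _]scale1r zlin !scale1r.
  rewrite !big_nil; apply: (addIr (vn_op z 0)).
  by have := zlin 1 0 0; rewrite !scale1r !add0r.
by move=> _ [s _ <-]; rewrite !opS; apply: eq_bigr => p _.
Qed.

(** The difference [z] is orthogonal to every sum [s] of simple tensors, so by Pythagoras its norm
    is at most that of [z - s], which density makes small. *)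
Lemma vt_vec_ext (x y : vn_space T) :
  (forall v w, hs_dot _ x (vt_vec T v w) = hs_dot _ y (vt_vec T v w)) -> x = y.
Proof.
move=> xy; set z := x - y.
have zO v w : hs_dot _ z (vt_vec T v w) = 0.
  by rewrite hs_dotDl -scaleN1r hs_dotZl xy mulN1r subrr.
have zS (s : seq (vn_space M * vn_space N)) :
    hs_dot _ z (\sum_(p <- s) vt_vec T p.1 p.2) = 0.
  elim: s => [|p s IHs]; first by rewrite big_nil -(scale0r 0) hs_dotZr rmorph0 mul0r.
  by rewrite big_cons hs_dotDr zO IHs addr0.
apply/eqP; rewrite -subr_eq0 -/z -normr_le0; apply/ler_addgt0Pr => e e0; rewrite add0r.
have [|_ [/[swap] [[s _ <-]]]] := @vt_vec_dense _ _ _ T _ _ (ball_open z e).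
  by exists z; exact: ballxx.
rewrite -ball_normE /= => /ltW ze; apply: le_trans ze.
rewrite -(@ler_pXn2r _ 2) ?nnegrE // !hs_normE (dnormB _ z) zS rmorph0 !addr0 subr0.
by rewrite lerDl.
Qed.

Lemma vt_tensDl a a' b : (a + a') [x] b = a [x] b + a' [x] b.
Proof.
by apply: vt_ext => v w; rewrite vn_opD !vt_tensE vn_opD linearDl.
Qed.

Lemma vt_tensDr a b b' : a [x] (b + b') = a [x] b + a [x] b'.
Proof.
by apply: vt_ext => v w; rewrite vn_opD !vt_tensE vn_opD linearDr.
Qed.

Lemma vt_tensZl c a b : (c *: a) [x] b = c *: (a [x] b).
Proof.
by apply: vt_ext => v w; rewrite vn_opZ !vt_tensE vn_opZ linearZl.
Qed.

Lemma vt_tensZr c a b : a [x] (c *: b) = c *: (a [x] b).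
Proof.
by apply: vt_ext => v w; rewrite vn_opZ !vt_tensE vn_opZ linearZr.
Qed.

Lemma vt_tensM a b a' b' : (a [x] b) * (a' [x] b') = (a * a') [x] (b * b').
Proof. by apply: vt_ext => v w; rewrite vn_opMv !vt_tensE !vn_opMv. Qed.

Lemma vt_tens_star a b : vn_star (a [x] b) = vn_star a [x] vn_star b.
Proof.
apply: vt_ext => v w; apply: vt_vec_ext => v' w'.
by rewrite vn_starP !vt_tensE !vt_vec_dot !vn_starP.
Qed.

Lemma vt_tens11 : 1 [x] 1 = 1.
Proof. by apply: vt_ext => v w; rewrite !vt_tensE !vn_op1. Qed.

End VnTensor.

(** * Normal functionals and their tensor products *)

(* [squares K] lists [0, K) x [0, K) and is a prefix of [squares K.+1]. *)
Fixpoint squares (K : nat) : seq (nat * nat) :=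
  if K is K'.+1 then
    squares K' ++ [seq (K', j) | j <- iota 0 K'] ++ [seq (i, K') | i <- iota 0 K]
  else [::].

(** An enumeration of pairs whose first [K ^ 2] values fill the square of side [K], so that double
    sums over squares factor. The list [squares n.+1] is long enough to have an entry of index
    [n]. *)
Definition square_enum (n : nat) : nat * nat := nth (0%N, 0%N) (squares n.+1) n.

Lemma size_squares K : size (squares K) = (K ^ 2)%N.
Proof.
elim: K => //= K IHK; rewrite !size_cat /= !size_map !size_iota IHK.
by rewrite -!mulnn mulSn mulnS; lia.
Qed.

Lemma nth_squares K K' n : (K <= K')%N -> (n < K ^ 2)%N ->
  nth (0%N, 0%N) (squares K') n = nth (0%N, 0%N) (squares K) n.
Proof.
move=> + nK; elim: K' => [|K' IHK']; first by rewrite leqn0 => /eqP->.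
rewrite leq_eqVlt => /predU1P[->//|]; rewrite ltnS => KK'.
rewrite /= nth_cat size_squares (leq_trans nK) ?leq_sqr //; exact: IHK'.
Qed.

Lemma sum_square_enum (A : pzSemiRingType) (u v : nat -> A) K :
  \sum_(0 <= n < K ^ 2) u (square_enum n).1 * v (square_enum n).2 =
  (\sum_(0 <= i < K) u i) * (\sum_(0 <= j < K) v j).
Proof.
transitivity (\sum_(p <- squares K) u p.1 * v p.2).
  rewrite (big_nth (0%N, 0%N)) size_squares; apply: eq_big_nat => n /andP[_ nK].
  have nn : (n < n.+1 ^ 2)%N by rewrite -!mulnn mulSn mulnS; lia.
  rewrite /square_enum; case: (leqP n.+1 K) => h; first by rewrite (nth_squares h).
  by rewrite (nth_squares (ltnW h)).
elim: K => [|K IHK]; first by rewrite !big_geq // mul0r big_nil.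
have -> : squares K.+1 = squares K ++ [seq (K, j) | j <- iota 0 K] ++
    [seq (i, K) | i <- iota 0 K ++ [:: K]].
  by rewrite -[[:: K]]/(iota (0 + K) 1) -iotaD addn1.
rewrite !big_cat IHK map_cat big_cat !big_map big_seq1.
rewrite !big_nat_recr //= mulrDl !mulrDr /index_iota !subn0.
rewrite [u K * (\sum_(_ <- _) _)]mulr_sumr [(\sum_(_ <- _) _) * v K]mulr_suml.
by rewrite -!addrA; congr (_ + _); rewrite addrCA.
Qed.

Section Predual.
Variables (R : realType) (M : vnAlgebra R).
Implicit Types (f g : M -> R[i]) (a b x : M).
Local Notation "''[' v , w ]" := (hs_dot (vn_space M) v w).

Lemma seq_lim_series_vn (xi eta : nat -> vn_space M) x :
  square_summable xi -> square_summable eta ->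
  exists l, seq_lim (series (fun n => '[vn_op x (xi n), eta n])) l.
Proof.
move=> [A A0 xiA] [B B0 etaB]; have [C C0 xC] := bounded_op_bound (vn_op_bounded x).
apply: (@abs_series_cvg _ _ (C ^+ 2 * A + B)) => n.
apply: le_trans (_ : \sum_(0 <= k < n) (C ^+ 2 * `|xi k| ^+ 2 + `|eta k| ^+ 2) <= _).
  apply: ler_sum => k _; rewrite (le_trans (norm_hs_dot _ _)) // lerD2r -exprMn.
  by rewrite ler_pXn2r ?nnegrE // mulr_ge0.
by rewrite big_split /= -mulr_sumr lerD // ler_wpM2l // exprn_ge0.
Qed.

Lemma predual_of_seqs (xi eta : nat -> vn_space M) f :
  square_summable xi -> square_summable eta ->
  (forall x, seq_lim (series (fun n => '[vn_op x (xi n), eta n])) (f x)) ->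
  predual f.
Proof. by move=> xiS etaS flim; apply/predualP; exists xi, eta. Qed.

Lemma predual_linear f : predual f -> forall c a b, f (c *: a + b) = c * f a + f b.
Proof.
move=> /predualP[xi [eta [_ _ flim]]] c a b.
apply: seq_lim_unique (flim _) _.
have := seq_limD (seq_limM (@seq_lim_cst R[i] c) (flim a)) (flim b).
congr (seq_lim _ _); apply/funext => n; rewrite /series /= mulr_sumr -big_split /=.
by apply: eq_bigr => k _; rewrite vn_opD vn_opZ hs_dotDl hs_dotZl.
Qed.

(** The factor [a] passes to the second sequence of vectors as its adjoint. *)
Lemma predual_mull f a : predual f -> predual (fun x => f (a * x)).
Proof.
move=> /predualP[xi [eta [xiS [B B0 etaB] flim]]].
refine (predual_of_seqs (eta := fun n => vn_op (vn_star a) (eta n)) xiS _ _) => [|x].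
  have [C C0 aC] := bounded_op_bound (vn_op_bounded (vn_star a)).
  exists (C ^+ 2 * B) => [|n]; first by rewrite mulr_ge0 // exprn_ge0.
  apply: le_trans (_ : \sum_(0 <= k < n) C ^+ 2 * `|eta k| ^+ 2 <= _).
    by apply: ler_sum => k _; rewrite -exprMn ler_pXn2r ?nnegrE // mulr_ge0.
  by rewrite -mulr_sumr ler_wpM2l // exprn_ge0.
have := flim (a * x); congr (seq_lim _ _); apply/funext => n.
by apply: eq_bigr => k _; rewrite vn_opMv vn_op_star.
Qed.

(** Conjugation exchanges the two sequences of vectors. *)
Lemma predual_star f : predual f -> predual (fun x => Num.conj (f (vn_star x))).
Proof.
move=> /predualP[xi [eta [xiS etaS flim]]].
refine (predual_of_seqs etaS xiS _) => x; apply/seq_limP => e e0.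
have := (seq_limP _ _).1 (flim (vn_star x)) e e0; apply: filterS => n.
rewrite -[X in X < e]norm_conjC rmorphB /= /series /= rmorph_sum /=.
congr (`| _ - _ | < e); apply: eq_bigr => k _.
by rewrite -hs_dotC vn_op_star.
Qed.

Lemma predual_vec (xi eta : vn_space M) : predual (fun x => '[vn_op x xi, eta]).
Proof.
pose delta (v : vn_space M) n : vn_space M := if n is 0%N then v else 0.
have deltaS v : square_summable (delta v).
  exists (`|v| ^+ 2) => [|n]; first by rewrite exprn_ge0.
  case: n => [|n]; first by rewrite big_geq // exprn_ge0.
  by rewrite big_nat_recl //= big1 ?addr0 // => k _; rewrite normr0 expr0n.
refine (predual_of_seqs (deltaS xi) (deltaS eta) _) => x.
apply/seq_limP => e e0; exists 1%N => // -[//|n] _.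
rewrite /series /= big_nat_recl //= big1 ?addr0 ?subrr ?normr0 // => k _.
by rewrite -(scale0r 0) hs_dotZr rmorph0 mul0r.
Qed.

Lemma predual_separates a b : (forall f, predual f -> f a = f b) -> a = b.
Proof. by move=> ab; apply: vn_ext => v w; exact: (ab _ (predual_vec v w)). Qed.

End Predual.

(** The representing vectors are the tensors of those of [f] and [g], listed along [square_enum];
    the functional is the limit of the resulting series. *)
Lemma tensor_functional_ex (R : realType) (M N : vnAlgebra R) (T : vnTensor M N)
    (f : M -> R[i]) (g : N -> R[i]) :
  predual f -> predual g -> exists F, @tensor_functional R M N T f g F.
Proof.
move=> /predualP[xi [eta [xiS etaS flim]]] /predualP[xi' [eta' [xi'S eta'S glim]]].
have nn n : (n <= n ^ 2)%N by case: n => // n; rewrite -mulnn leq_pmulr.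
pose tens (u : nat -> vn_space M) (v : nat -> vn_space N) n :=
  vt_vec T (u (square_enum n).1) (v (square_enum n).2).
have tensS u v : square_summable u -> square_summable v -> square_summable (tens u v).
  move=> [A A0 uA] [B B0 vB]; exists (A * B) => [|n]; first exact: mulr_ge0.
  (* The terms are nonnegative, so the sum may be extended to a full square, where it factors. *)
  apply: (@le_trans _ _ (\sum_(0 <= k < n ^ 2) `|tens u v k| ^+ 2)).
    rewrite (big_cat_nat (leq0n n) (nn n)) /=.
    by rewrite lerDl sumr_ge0 // => k _; rewrite exprn_ge0.
  under eq_bigr do rewrite hs_normE vt_vec_dot -!hs_normE.
  rewrite (sum_square_enum (fun i => `|u i| ^+ 2) (fun j => `|v j| ^+ 2)).
  by rewrite ler_pM // ?sumr_ge0 // => k _; exact: exprn_ge0.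
have limT x := seq_lim_series_vn x (tensS _ _ xiS xi'S) (tensS _ _ etaS eta'S).
have [F FE] := choice limT.
exists F; split=> [|a b].
  exact: predual_of_seqs (tensS _ _ xiS xi'S) (tensS _ _ etaS eta'S) FE.
(* Along full squares the partial sums are products of partial sums for [f] and [g], and a
   subsequence has the same limit. *)
apply: seq_lim_unique (seq_lim_sub nn (FE (vt_tens T a b))) _.
have := seq_limM (flim a) (glim b); congr (seq_lim _ _); apply/funext => n.
rewrite /series /= -sum_square_enum; apply: eq_bigr => k _.
by rewrite vt_tensE vt_vec_dot.
Qed.

(** * Linear algebra *)

Section Subspaces.
Variable K : fieldType.

(** Among the subspaces contained in [S], take one of maximal dimension: adjoining a vector of [S]
    cannot enlarge it. *)
Lemma vspace_of_linear_closed (V : vectType K) (S : set V) : S 0 ->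
  (forall c u v, S u -> S v -> S (c *: u + v)) ->
  exists W : {vspace V}, forall v, v \in W <-> S v.
Proof.
move=> S0 SL.
pose P d := `[< exists2 W : {vspace V}, (forall v, v \in W -> S v) & \dim W = d >].
have exP : exists d, P d.
  exists 0%N; apply/asboolP; exists 0%VS; last by rewrite dimv0.
  by move=> v; rewrite memv0 => /eqP->.
have leP d : P d -> (d <= \dim {:V})%N.
  by move=> /asboolP[W _ <-]; exact: dimvS (subvf W).
have [d /asboolP[W WS dimW] dmax] := ex_maxnP exP leP.
exists W => v; split=> [|Sv]; first exact: WS.
have : (W == W + <[v]>)%VS.
  rewrite eqEdim addvSl /= dimW; apply/dmax/asboolP; exists (W + <[v]>)%VS => // u.
  move=> /memv_addP[w wW [_ /vlineP[c ->] ->]]; rewrite addrC.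
  by apply: SL => //; exact: WS.
by move=> /eqP ->; rewrite memvE addvSr.
Qed.

(** The double annihilator theorem: the columns of the cokernel of a basis matrix of [S] are killed
    by [S], hence by [w], which puts [w] in the row space. *)
Lemma linear_closed_annihilator n (S : set 'rV[K]_n) (w : 'rV[K]_n) : S 0 ->
  (forall c u v, S u -> S v -> S (c *: u + v)) ->
  (forall v : 'cV[K]_n, (forall u, S u -> u *m v = 0) -> w *m v = 0) -> S w.
Proof.
move=> S0 SL wann; have [W WS] := vspace_of_linear_closed S0 SL.
pose A := \matrix_i (vbasis W)`_i : 'M[K]_(\dim W, n).
have rowA i : row i A = (vbasis W)`_i by rewrite rowK.
have /submxP[D ->] : (w <= A)%MS.
  rewrite submxE; apply/eqP/matrixP => i j.
  suff /matrixP/(_ i 0) : w *m (cokermx A *m delta_mx j (0 : 'I_1)) = 0.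
    by rewrite mulmxA -colE [LHS]mxE => ->; rewrite !mxE.
  apply: wann => u /WS uW; rewrite mulmxA; apply/eqP.
  suff /submxP[B ->] : (u <= A)%MS by rewrite -(mulmxA B) mulmx_coker mulmx0 mul0mx.
  rewrite (coord_vbasis uW); apply: summx_sub => k _.
  by rewrite scalemx_sub // -rowA row_sub.
apply/WS; rewrite mulmx_sum_row; apply: memv_suml => i _.
by rewrite memvZ // rowA vbasis_mem // mem_nth // size_tuple.
Qed.

End Subspaces.

(** * Adjoint matrices and positive definite forms *)

Section Adjoint.
Variable C : numClosedFieldType.

Definition adjmx m n (A : 'M[C]_(m, n)) := (map_mx Num.conj A)^T.

Lemma adjmxM m n p (A : 'M[C]_(m, n)) (B : 'M[C]_(n, p)) :
  adjmx (A *m B) = adjmx B *m adjmx A.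
Proof. by rewrite /adjmx map_mxM trmx_mul. Qed.

Lemma adjmxK m n (A : 'M[C]_(m, n)) : adjmx (adjmx A) = A.
Proof. by apply/matrixP => i j; rewrite !mxE conjCK. Qed.

Lemma adjmxZ m n (c : C) (A : 'M[C]_(m, n)) : adjmx (c *: A) = Num.conj c *: adjmx A.
Proof. by apply/matrixP => i j; rewrite !mxE rmorphM. Qed.

Lemma adjmx1 n : adjmx (1%:M : 'M[C]_n) = 1%:M.
Proof. by rewrite /adjmx map_mx1 trmx1. Qed.

Lemma mul_adjmx_diag m n (A : 'M[C]_(m, n)) j :
  (adjmx A *m A) j j = \sum_i `|A i j| ^+ 2.
Proof. by rewrite !mxE; apply: eq_bigr => i _; rewrite !mxE normCK mulrC. Qed.

Lemma posdef_unitmx n (Q : 'M[C]_n) :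
  (forall d : 'cV_n, adjmx d *m Q *m d = 0 -> d = 0) -> Q \in unitmx.
Proof.
move=> Qpos; rewrite -unitmx_tr -row_free_unit -kermx_eq0; apply/rowV0P => u.
move=> /sub_kermxP uQ; apply: trmx_inj; rewrite trmx0; apply: Qpos.
by rewrite -mulmxA -[Q]trmxK -trmx_mul uQ trmx0 mulmx0.
Qed.

(** By the spectral theorem [Q] is unitarily diagonal; [S] is the square root of the diagonal part
    times the diagonalizing unitary. *)
Lemma posdef_factor n (Q : 'M[C]_n) :
  adjmx Q = Q -> (forall d : 'cV_n, 0 <= (adjmx d *m Q *m d) 0 0) -> Q \in unitmx ->
  exists2 S, S \in unitmx & Q = adjmx S *m S.
Proof.
move=> Qherm Qpos Qunit.
have /orthomx_spectralP QE : Q \is normalmx.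
  apply: hermitian_normalmx; apply/is_hermitianmxP.
  by rewrite expr0 scale1r -{1}Qherm /adjmx map_trmx.
set P := spectralmx Q in QE; set D := spectral_diag Q in QE.
have Punit : P \in unitmx := spectral_unit Q.
have PP : P *m adjmx P = 1%:M.
  by have /unitarymxP := spectral_unitarymx Q; rewrite /adjmx map_trmx.
have invP : invmx P = adjmx P by rewrite -[RHS](mulKmx Punit) PP mulmx1.
have DE : diag_mx D = P *m Q *m adjmx P.
  by rewrite QE invP !mulmxA PP mul1mx -mulmxA PP mulmx1.
(* Each eigenvalue is the value of the form at an eigenvector, the adjoint of a row of [P]. *)
have D0 i : 0 <= D 0 i.
  have := Qpos (adjmx (row i P)); rewrite adjmxK.
  suff -> : (row i P *m Q *m adjmx (row i P)) 0 0 = diag_mx D i i by rewrite mxE eqxx.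
  by rewrite DE -row_mul !mxE; apply: eq_bigr => k _; rewrite !mxE.
pose S := diag_mx (map_mx sqrtC D) *m P.
have QS : Q = adjmx S *m S.
  rewrite adjmxM QE invP -!mulmxA; congr (_ *m _); rewrite mulmxA; congr (_ *m _).
  rewrite /adjmx map_diag_mx tr_diag_mx mulmx_diag; congr diag_mx.
  apply/rowP => i; rewrite !mxE /= geC0_conj ?sqrtC_ge0 //.
  by rewrite -expr2 sqrtCK.
exists S => //.
by move: Qunit; rewrite QS unitmx_mul => /andP[].
Qed.

End Adjoint.

Section PredualTheory.
Variables (R : realType) (M : vnAlgebra R) (f : M -> R[i]) (fL1 : predual f).

Lemma predualD a b : f (a + b) = f a + f b.
Proof. by rewrite -[a]scale1r predual_linear // mul1r scale1r. Qed.

Lemma predual0 : f 0 = 0.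
Proof. by apply: (addIr (f 0)); rewrite -predualD !add0r. Qed.

Lemma predualZ c a : f (c *: a) = c * f a.
Proof. by rewrite -[c *: a]addr0 predual_linear // predual0 addr0. Qed.

Lemma predual_sum (I : Type) (r : seq I) (P : pred I) (F : I -> M) :
  f (\sum_(i <- r | P i) F i) = \sum_(i <- r | P i) f (F i).
Proof. exact: (big_morph f predualD predual0). Qed.

End PredualTheory.

(** * The Haar state and co-representations *)

Section TensorEmbeddings.
Variables (R : realType) (M N : vnAlgebra R) (T : vnTensor M N).

(** As ring morphisms, the two embeddings let the co-representation identity be written as a product
    of matrices over the tensor product. *)
Definition vt_inl (a : M) : T := vt_tens T a 1.
Definition vt_inr (b : N) : T := vt_tens T 1 b.

Lemma vt_tens_inlr a b : vt_tens T a b = vt_inl a * vt_inr b.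
Proof. by rewrite vt_tensM mulr1 mul1r. Qed.

Lemma vt_tens_inrl a b : vt_tens T a b = vt_inr b * vt_inl a.
Proof. by rewrite vt_tensM mulr1 mul1r. Qed.

Fact vt_inl_zmod_morphism : zmod_morphism vt_inl.
Proof. by move=> a a'; rewrite /vt_inl -scaleN1r vt_tensDl vt_tensZl scaleN1r. Qed.

Fact vt_inr_zmod_morphism : zmod_morphism vt_inr.
Proof. by move=> a a'; rewrite /vt_inr -scaleN1r vt_tensDr vt_tensZr scaleN1r. Qed.

Fact vt_inl_monoid_morphism : monoid_morphism vt_inl.
Proof. by split=> [|a a']; rewrite /vt_inl ?vt_tens11 // vt_tensM mulr1. Qed.

Fact vt_inr_monoid_morphism : monoid_morphism vt_inr.
Proof. by split=> [|a a']; rewrite /vt_inr ?vt_tens11 // vt_tensM mulr1. Qed.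

HB.instance Definition _ :=
  GRing.isZmodMorphism.Build M T vt_inl vt_inl_zmod_morphism.
HB.instance Definition _ :=
  GRing.isMonoidMorphism.Build M T vt_inl vt_inl_monoid_morphism.
HB.instance Definition _ :=
  GRing.isZmodMorphism.Build N T vt_inr vt_inr_zmod_morphism.
HB.instance Definition _ :=
  GRing.isMonoidMorphism.Build N T vt_inr vt_inr_monoid_morphism.

End TensorEmbeddings.

Notation scalar_coef G := (map_mx (GRing.in_alg G)).

Section ScalarCoefficients.
Variables (R : realType) (M : vnAlgebra R).
Local Notation sc := (scalar_coef M).

Lemma map_predual_mull (f : M -> R[i]) m n p (P : 'M[R[i]]_(m, n)) (A : 'M[M]_(n, p)) :
  predual f -> map_mx f (scalar_coef M P *m A) = P *m map_mx f A.
Proof.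
move=> fL1; apply/matrixP => i j; rewrite !mxE predual_sum //.
by apply: eq_bigr => k _; rewrite !mxE mulr_algl predualZ.
Qed.

Lemma map_predual_mulr (f : M -> R[i]) m n p (A : 'M[M]_(m, n)) (P : 'M[R[i]]_(n, p)) :
  predual f -> map_mx f (A *m scalar_coef M P) = map_mx f A *m P.
Proof.
move=> fL1; apply/matrixP => i j; rewrite !mxE predual_sum //.
by apply: eq_bigr => k _; rewrite !mxE mulr_algr predualZ // mulrC.
Qed.

Lemma mx_predual_separates m n (A B : 'M[M]_(m, n)) :
  (forall f, predual f -> map_mx f A = map_mx f B) -> A = B.
Proof.
move=> AB; apply/matrixP => i j; apply: predual_separates => f /AB /matrixP/(_ i j).
by rewrite !mxE.
Qed.

(** Over a noncommutative algebra transposition does not reverse products in general; it does here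
    because scalar entries are central. *)
Lemma tr_scalar_coef_mulr m n p (A : 'M[M]_(m, n)) (P : 'M[R[i]]_(n, p)) :
  (A *m sc P)^T = sc P^T *m A^T.
Proof.
apply/matrixP => i j; rewrite !mxE; apply: eq_bigr => k _.
by rewrite !mxE mulr_algl mulr_algr.
Qed.

Lemma map_star_scalar_coef m n (P : 'M[R[i]]_(m, n)) :
  map_mx (@vn_star _ M) (sc P) = sc (map_mx Num.conj P).
Proof. by apply/matrixP => i j; rewrite !mxE vn_starZ vn_star1. Qed.

Lemma map_star_mulmx m n p (A : 'M[M]_(m, n)) (B : 'M[M]_(n, p)) :
  (map_mx (@vn_star _ M) (A *m B))^T =
  (map_mx (@vn_star _ M) B)^T *m (map_mx (@vn_star _ M) A)^T.
Proof.
apply/matrixP => i j; rewrite !mxE vn_star_sum; apply: eq_bigr => k _.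
by rewrite !mxE vn_starM.
Qed.

Lemma map_star_mulr m n p (A : 'M[M]_(m, n)) (P : 'M[R[i]]_(n, p)) :
  map_mx (@vn_star _ M) (A *m sc P) =
  map_mx (@vn_star _ M) A *m sc (map_mx Num.conj P).
Proof.
apply/matrixP => i j; rewrite !mxE vn_star_sum; apply: eq_bigr => k _.
by rewrite !mxE !mulr_algr vn_starZ.
Qed.

End ScalarCoefficients.

Section Haar.
Variables (R : realType) (G : compactQuantumGroup R).
Local Notation h := (@haar R G).
Local Notation star := (@vn_star R G).
Local Notation "a '[x]' b" := (vt_tens (Linfty2 G) a b) (at level 40).

Lemma haarD x y : h (x + y) = h x + h y.
Proof. exact: (predualD (haar_normal G)). Qed.

Lemma haarZ c x : h (c *: x) = c * h x.
Proof. exact: (predualZ (haar_normal G)). Qed.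

Lemma haar_sum (I : Type) (r : seq I) (P : pred I) (F : I -> G) :
  h (\sum_(i <- r | P i) F i) = \sum_(i <- r | P i) h (F i).
Proof. exact: (predual_sum (haar_normal G)). Qed.

(** Positivity at [c *: 1 + x] makes [Num.conj c * h x + c * h (star x)] real for every [c]; the
    values 1 and ['i] of [c] give the claim. *)
Lemma haar_star x : h (star x) = Num.conj (h x).
Proof.
have real (c : R[i]) : Num.conj (Num.conj c * h x + c * h (star x)) =
    Num.conj c * h x + c * h (star x).
  have E : star (c *: 1 + x) * (c *: 1 + x) =
      (Num.conj c * c) *: 1 + (Num.conj c *: x + c *: star x) + star x * x.
    rewrite vn_starD vn_starZ vn_star1 mulrDl !mulrDr -!scalerAl -!scalerAr.
    by rewrite !mul1r mulr1 scalerA -!addrA.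
  have := haar_ge0 (c *: 1 + x); rewrite E !haarD !haarZ haar1 mulr1.
  have x0 := haar_ge0 x.
  have c0 : 0 <= Num.conj c * c by rewrite mulrC -normCK exprn_ge0.
  move=> /ger0_real y0; apply/CrealP.
  have := rpredB (rpredB y0 (ger0_real x0)) (ger0_real c0).
  by rewrite addrK addrAC subrr add0r.
have := real 1; rewrite rmorph1 !mul1r rmorphD => sumE.
have := real 'i; rewrite conjCi !mulNr rmorphD rmorphN !rmorphM /= conjCi => difE.
have /(mulfI (neq0Ci _)) difE' : 'i * (Num.conj (h x) - Num.conj (h (star x))) =
    'i * (h (star x) - h x) :> R[i].
  by rewrite !mulrBr -[RHS]addrC -difE !mulNr opprK.
have /(mulfI _) : 2%:R * h (star x) = 2%:R * Num.conj (h x).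
  transitivity ((h x + h (star x)) + (h (star x) - h x)); first by ring.
  by rewrite -difE' -sumE; ring.
by apply; rewrite pnatr_eq0.
Qed.

Section Invariance.
Variables (I : finType) (a b : I -> G) (x : G).
Hypothesis coprod_x : coproduct G x = \sum_i a i [x] b i.

(** Invariance is stated after pairing with normal functionals; as these separate points, it lifts
    to an identity in the algebra. *)
Lemma haar_invariance_l : \sum_i h (a i) *: b i = h x *: 1.
Proof.
apply: predual_separates => f fL1.
have [F FE] := tensor_functional_ex (Linfty2 G) (haar_normal G) fL1.
have := haar_right fL1 FE x; rewrite coprod_x (predual_sum FE.1) predual_sum //.
rewrite predualZ // mulrC => <-; apply: eq_bigr => i _.
by rewrite FE.2 predualZ.
Qed.

Lemma haar_invariance_r : \sum_i h (b i) *: a i = h x *: 1.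
Proof.
apply: predual_separates => f fL1.
have [F FE] := tensor_functional_ex (Linfty2 G) fL1 (haar_normal G).
have := haar_left fL1 FE x; rewrite coprod_x (predual_sum FE.1) predual_sum //.
rewrite predualZ // mulrC => <-; apply: eq_bigr => i _.
by rewrite FE.2 predualZ // mulrC.
Qed.

End Invariance.

(** Split off from [unitary_corep] because the conjugate of a unitary co-representation satisfies it
    without having to be unitary. *)
Definition corep n (U : 'M[G]_n) : Prop :=
  forall i j, coproduct G (U i j) = \sum_t U i t [x] U t j.

Lemma corepP n (U : 'M[G]_n) : corep U <->
  map_mx (coproduct G) U =
  map_mx (@vt_inl _ _ _ (Linfty2 G)) U *m map_mx (@vt_inr _ _ _ (Linfty2 G)) U.
Proof.
split=> [Uc|/matrixP Uc i j].
  apply/matrixP => i j; rewrite !mxE Uc; apply: eq_bigr => t _.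
  by rewrite !mxE vt_tens_inlr.
have := Uc i j; rewrite !mxE => ->; apply: eq_bigr => t _.
by rewrite !mxE vt_tens_inlr.
Qed.

Section TensorProduct.
Variables (m n : nat) (U : 'M[G]_m) (V : 'M[G]_n).
Hypotheses (Uc : corep U) (Vc : corep V).

Let coproductUV i l j t : coproduct G (U i l * V j t) =
  \sum_(ab : 'I_m * 'I_n) (U i ab.1 * V j ab.2) [x] (U ab.1 l * V ab.2 t).
Proof.
rewrite rmorphM /= Uc Vc big_distrlr pair_bigA /=.
by apply: eq_bigr => ab _; rewrite vt_tensM.
Qed.

(** Haar averaging: invariance at the products [U i l * V j t] makes the matrix of their integrals a
    fixed vector. Such matrices later serve as intertwiners. *)
Lemma haar_corep_l i j : let Z := \matrix_(a, b) h (U i a * V j b) in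
  U^T *m scalar_coef G Z *m V = scalar_coef G Z.
Proof.
move=> Z; apply/matrixP => l t.
rewrite [RHS]mxE [in RHS]mxE -[RHS](haar_invariance_l (coproductUV i l j t)).
rewrite !mxE; under eq_bigr do rewrite mxE big_distrl.
rewrite exchange_big pair_bigA /=; apply: eq_bigr => -[a b] _ /=.
by rewrite !mxE mulr_algr -scalerAl.
Qed.

Lemma haar_corep_r l t : let W := \matrix_(a, b) h (U a l * V b t) in
  U *m scalar_coef G W *m V^T = scalar_coef G W.
Proof.
move=> W; apply/matrixP => i j.
rewrite [RHS]mxE [in RHS]mxE -[RHS](haar_invariance_r (coproductUV i l j t)).
rewrite !mxE; under eq_bigr do rewrite mxE big_distrl.
rewrite exchange_big pair_bigA /=; apply: eq_bigr => -[a b] _ /=.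
by rewrite !mxE mulr_algr -scalerAl.
Qed.

End TensorProduct.

End Haar.

(** * The conjugate co-representation *)

Section Conjugate.
Variables (R : realType) (G : compactQuantumGroup R).
Local Notation h := (@haar R G).
Local Notation star := (@vn_star R G).
Local Notation sc := (scalar_coef G).

Lemma scalar_coef_eq0 m n (P : 'M[R[i]]_(m, n)) : sc P = 0 -> P = 0.
Proof.
move=> /matrixP P0; apply/matrixP => i j; have := congr1 h (P0 i j).
by rewrite !mxE haarZ haar1 mulr1 (predual0 (haar_normal G)).
Qed.

Lemma haar_mulstar_ge0 y : 0 <= h (y * star y).
Proof. by rewrite -{1}[y]vn_starK haar_ge0. Qed.

Lemma haar_mulstar_eq0 y : h (y * star y) = 0 -> y = 0.
Proof.
by rewrite -{1}[y]vn_starK => /haar_faithful ys; rewrite -[y]vn_starK ys vn_star0.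
Qed.

Lemma corep_star n (U : 'M[G]_n) : corep U -> corep (map_mx star U).
Proof.
move=> Uc i j; rewrite mxE (coproduct_normal G).1 Uc vn_star_sum.
by apply: eq_bigr => t _; rewrite vt_tens_star !mxE.
Qed.

Lemma corep_conj n (U : 'M[G]_n) (P Q : 'M[R[i]]_n) :
  Q *m P = 1%:M -> corep U -> corep (sc P *m U *m sc Q).
Proof.
move=> QP /corepP Uc; apply/corepP.
have scD (f : {rmorphism G -> Linfty2 G}) : (forall c, f c%:A = c%:A) ->
    forall A : 'M[R[i]]_n, map_mx f (sc A) = scalar_coef (Linfty2 G) A.
  by move=> fA A; apply/matrixP => i j; rewrite !mxE /= fA.
have scl c : vt_inl (Linfty2 G) c%:A = c%:A by rewrite /vt_inl vt_tensZl vt_tens11.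
have scr c : vt_inr (Linfty2 G) c%:A = c%:A by rewrite /vt_inr vt_tensZr vt_tens11.
rewrite !map_mxM Uc !scD; try by [exact: scl | exact: scr | exact: rmorph_alg].
rewrite !mulmxA; congr (_ *m _ *m _); rewrite -[RHS]mulmxA -map_mxM QP map_mx1.
by rewrite mulmx1.
Qed.

Variables (n : nat) (U : 'M[G]_n).
Hypothesis Uunit : unitary_corep U.
Local Notation Ubar := (map_mx star U).

Let UUbar : U *m Ubar^T = 1%:M. Proof. by case: Uunit. Qed.
Let UbarU : Ubar^T *m U = 1%:M. Proof. by case: Uunit. Qed.
Let Uc : corep U. Proof. by case: Uunit. Qed.
Let Ubarc : corep Ubar. Proof. exact: corep_star. Qed.

(* Conjugation by a square root of [haar_gram] makes [Ubar] unitary. *)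
Definition haar_gram : 'M[R[i]]_n := map_mx h (U^T *m Ubar).

Lemma haar_gram_corep : U^T *m sc haar_gram *m Ubar = sc haar_gram.
Proof.
have -> : haar_gram = \sum_k \matrix_(a, b) h (U k a * Ubar k b).
  apply/matrixP => a b; rewrite !mxE summxE haar_sum.
  by apply: eq_bigr => k _; rewrite !mxE.
rewrite raddf_sum /= mulmx_sumr mulmx_suml; apply: eq_bigr => k _.
exact: (haar_corep_l Uc Ubarc).
Qed.

(** A sum of squares for the Haar state: this yields positivity, and by faithfulness also
    definiteness. *)
Let haar_gram_form (d : 'cV[R[i]]_n) : let y := U *m sc (map_mx Num.conj d) in
  (adjmx d *m haar_gram *m d) 0 0 = \sum_k h (y k 0 * star (y k 0)).
Proof.
move=> y; have -> : adjmx d *m haar_gram *m d = map_mx h (y^T *m map_mx star y).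
  rewrite -map_predual_mull; last exact: haar_normal.
  rewrite -map_predual_mulr; last exact: haar_normal.
  congr map_mx; rewrite /y tr_scalar_coef_mulr map_star_mulr !mulmxA.
  by congr (_ *m sc _); apply/matrixP => a b; rewrite !mxE conjCK.
rewrite !mxE haar_sum; apply: eq_bigr => k _.
by rewrite ![_ 0 k]mxE ![map_mx star y k 0]mxE.
Qed.

Lemma haar_gram_ge0 (d : 'cV[R[i]]_n) : 0 <= (adjmx d *m haar_gram *m d) 0 0.
Proof.
by rewrite haar_gram_form; apply: sumr_ge0 => k _; exact: haar_mulstar_ge0.
Qed.

Lemma haar_gram_unit : haar_gram \in unitmx.
Proof.
apply: posdef_unitmx => d /matrixP/(_ 0 0); rewrite haar_gram_form [RHS]mxE.
move=> /psumr_eq0P y0; have : U *m sc (map_mx Num.conj d) = 0.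
  apply/matrixP => k j; rewrite [RHS]mxE ord1; apply: haar_mulstar_eq0.
  by apply: y0 => // l _; exact: haar_mulstar_ge0.
move/(congr1 (mulmx Ubar^T)); rewrite mulmxA UbarU mul1mx mulmx0 => /scalar_coef_eq0.
by move=> /matrixP d0; apply/matrixP => a b; have := d0 a b;
  rewrite !mxE => /eqP; rewrite conjC_eq0 => /eqP.
Qed.

Lemma haar_gram_herm : adjmx haar_gram = haar_gram.
Proof.
apply/matrixP => a b; rewrite !mxE -haar_star vn_star_sum; congr h.
by apply: eq_bigr => k _; rewrite !mxE vn_starM vn_starK.
Qed.

(* [haar_gram] only yields a left inverse of [Ubar], which need not be a right
   inverse in infinite dimension; [haar_gram'] yields a right one. *)
Let haar_gram' : 'M[R[i]]_n := map_mx h (Ubar *m U^T).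

Let haar_gram'_corep : Ubar *m sc haar_gram' *m U^T = sc haar_gram'.
Proof.
have -> : haar_gram' = \sum_t \matrix_(a, b) h (Ubar a t * U b t).
  apply/matrixP => a b; rewrite !mxE summxE haar_sum.
  by apply: eq_bigr => k _; rewrite !mxE.
rewrite raddf_sum /= mulmx_sumr mulmx_suml; apply: eq_bigr => k _.
exact: (haar_corep_r Ubarc Uc).
Qed.

Let haar_gram'_unit : haar_gram' \in unitmx.
Proof.
apply: posdef_unitmx => d; pose y := U^T *m sc d.
have -> : adjmx d *m haar_gram' *m d = map_mx h ((map_mx star y)^T *m y).
  rewrite -map_predual_mull; last exact: haar_normal.
  rewrite -map_predual_mulr; last exact: haar_normal.
  congr map_mx; rewrite map_star_mulmx map_star_scalar_coef /adjmx.
  by rewrite -!map_trmx trmxK !mulmxA.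
move=> /matrixP/(_ 0 0); rewrite !mxE haar_sum => /psumr_eq0P y0.
have : y = 0.
  apply/matrixP => k j; rewrite [RHS]mxE ord1; apply: haar_faithful.
  have := y0 _ k isT; rewrite ![_ 0 k]mxE ![map_mx star y k 0]mxE; apply.
  by move=> l _; rewrite ![_ 0 l]mxE ![map_mx star y l 0]mxE haar_ge0.
rewrite /y => /(congr1 trmx); rewrite tr_scalar_coef_mulr trmxK trmx0.
move/(congr1 (mulmx^~ Ubar^T)); rewrite -mulmxA UUbar mulmx1 mul0mx.
by move=> /scalar_coef_eq0 /(congr1 trmx); rewrite trmxK trmx0.
Qed.

Let scV (P : 'M[R[i]]_n) : P \in unitmx ->
  sc P *m sc (invmx P) = 1%:M /\ sc (invmx P) *m sc P = 1%:M.
Proof. by move=> Pu; rewrite -!map_mxM mulmxV // mulVmx // map_mx1. Qed.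

(** [L] is a left inverse of [Ubar] and [K] a right inverse, so they coincide. *)
Lemma conj_corep_inverse :
  Ubar *m sc (invmx haar_gram) *m U^T *m sc haar_gram = 1%:M.
Proof.
have [QV VQ] := scV haar_gram_unit; have [RV VR] := scV haar_gram'_unit.
set L := sc (invmx haar_gram) *m U^T *m sc haar_gram.
have LU : L *m Ubar = 1%:M.
  by rewrite /L -!mulmxA (mulmxA U^T) haar_gram_corep.
set K := sc haar_gram' *m U^T *m sc (invmx haar_gram').
have UK : Ubar *m K = 1%:M by rewrite /K !mulmxA haar_gram'_corep.
have LK : L = K by rewrite -[L]mulmx1 -UK mulmxA LU mul1mx.
by rewrite -UK -LK /L !mulmxA.
Qed.

End Conjugate.

Section ConjugateIrreducible.
Variables (R : realType) (G : compactQuantumGroup R).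
Local Notation star := (@vn_star R G).
Local Notation sc := (scalar_coef G).

Lemma map_predual_star n (U : 'M[G]_n) (f : G -> R[i]) :
  map_mx f (map_mx star U) =
  map_mx Num.conj (map_mx (fun x => Num.conj (f (star x))) U).
Proof. by apply/matrixP => i j; rewrite !mxE conjCK. Qed.

(** With [Q] factored as [adjmx S *m S], conjugating [Ubar] by [S] gives a unitary irreducible [V],
    to which completeness of the family applies; [X] is the resulting equivalence times [S]. *)
Lemma conj_corep_equiv (Irr : irrFamily G) n (U : 'M[G]_n) :
  unitary_corep U -> irreducible_corep U ->
  exists (q : Irr) (X : 'M[R[i]]_(irr_dim q, n)),
    (exists Y, Y *m X = 1%:M) /\
    (forall f, L1 f -> X *m map_mx f (map_mx star U) = rep_of (irr_coef q) f *m X).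
Proof.
move=> Uunit [n0 Uirr]; set Ubar := map_mx star U.
have Qunit := haar_gram_unit Uunit; set Q := haar_gram U in Qunit.
have [S Sunit QS] := posdef_factor (haar_gram_herm U) (haar_gram_ge0 U) Qunit.
rewrite -/Q in QS.
have adjSV : adjmx (invmx S) *m adjmx S = 1%:M by rewrite -adjmxM mulmxV // adjmx1.
have VQ : invmx Q = invmx S *m adjmx (invmx S).
  suff VQ : invmx S *m adjmx (invmx S) *m Q = 1%:M.
    by rewrite -[RHS](mulmxK Qunit) VQ mul1mx.
  by rewrite QS -mulmxA (mulmxA (adjmx _)) adjSV mul1mx mulVmx.
pose V := sc S *m Ubar *m sc (invmx S).
have starV : mx_star V = sc (adjmx (invmx S)) *m U^T *m sc (adjmx S).
  rewrite /mx_star /V map_star_mulmx map_star_mulmx !map_star_scalar_coef.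
  rewrite -!map_trmx mulmxA; congr (_ *m _^T *m _).
  by apply/matrixP => i j; rewrite !mxE vn_starK.
have Vc : corep V by apply: corep_conj; [exact: mulVmx | apply/corep_star; case: Uunit].
have fV f : L1 f -> map_mx f V = S *m map_mx f Ubar *m invmx S.
  by move=> fL1; rewrite -(map_predual_mull S Ubar fL1); exact: map_predual_mulr.
have Vunit : unitary_corep V.
  split=> //; rewrite starV /V.
    (* This is [conj_corep_inverse] multiplied on the right by the inverse of [Q]. *)
    have UQ : Ubar *m sc (invmx Q) *m U^T = sc (invmx Q).
      rewrite -[LHS]mulmx1 -[1%:M](map_mx1 (GRing.in_alg G)) -(mulmxV Qunit) map_mxM.
      by rewrite mulmxA conj_corep_inverse // mul1mx.
    rewrite !mulmxA -(mulmxA (_ *m Ubar)) -map_mxM -VQ -!(mulmxA (sc S)) UQ.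
    rewrite -!map_mxM VQ !mulmxA mulmxV // mul1mx adjSV; exact: map_mx1.
  rewrite !mulmxA -(mulmxA (_ *m U^T)) -map_mxM -QS -!(mulmxA (sc (adjmx _))).
  have -> : U^T *m sc Q *m Ubar = sc Q := haar_gram_corep Uunit.
  rewrite -!map_mxM QS !mulmxA mulmxK // adjSV; exact: map_mx1.
have Virr : irreducible_corep V.
  split=> [|E Einv]; first exact: n0.
  (* At [f], [Ubar] is the complex conjugate of [U] at the adjoint functional. Undoing [S] and
     conjugating coordinates thus carries a [V]-invariant subspace to a [U]-invariant one. *)
  have [|c u v Eu Ev|W WE] :=
      @vspace_of_linear_closed _ _ [set w : 'cV_n | S *m map_mx Num.conj w \in E].
  - by rewrite /= map_mx0 mulmx0 mem0v.
  - by rewrite /= map_mxD map_mxZ mulmxDr -scalemxAr; apply: memvD; [exact: memvZ|].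
  have Winv f v : L1 f -> v \in W -> rep_of U f *m v \in W.
    move=> fL1 /WE /= vE; apply/WE => /=; rewrite map_mxM.
    have := Einv _ _ (predual_star fL1) vE.
    rewrite /rep_of fV; last exact: predual_star.
    rewrite map_predual_star mulmxA (mulmxKV Sunit) -mulmxA.
    by congr (S *m (_ *m _) \in E); apply/matrixP => i j; rewrite !mxE vn_starK conjCK.
  have EW v : v \in E <-> map_mx Num.conj (invmx S *m v) \in W.
    rewrite WE /= -map_mx_comp (eq_map_mx_id _ (fun x => _)) ?mulKVmx //.
    by move=> x /=; rewrite conjCK.
  case: (Uirr W Winv) => W0; [left|right]; apply/vspaceP => v.
    rewrite memv0; apply/idP/eqP => [/EW|->]; last exact: mem0v.
    rewrite W0 memv0 => /eqP Sv; rewrite -[v](mulKVmx Sunit).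
    suff -> : invmx S *m v = 0 by rewrite mulmx0.
    apply/matrixP => i j; move/matrixP/(_ i j): Sv; rewrite ![_ _ i j]mxE.
    by move=> /eqP; rewrite conjC_eq0 => /eqP.
  by rewrite memvf; apply/EW; rewrite W0 memvf.
have [q [T [TT' T'T TV]]] := irr_complete Irr Vunit Virr.
exists q, (T *m S); split=> [|f fL1].
  exists (invmx S *m adjmx T); rewrite -mulmxA (mulmxA (adjmx T)).
  by rewrite -[adjmx T]/((map_mx _ T)^T) T'T mul1mx mulVmx.
by rewrite mulmxA -(TV _ fL1) /rep_of (fV _ fL1) -!mulmxA mulVmx // mulmx1.
Qed.

End ConjugateIrreducible.

(** * Schur's lemma and orthogonality *)

Section Schur.
Variables (R : realType) (G : compactQuantumGroup R).
Local Notation star := (@vn_star R G).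
Local Notation sc := (scalar_coef G).

(** An eigenspace of [A] is invariant and nonzero, hence the whole space. The transpose enters
    because [eigenvalue] speaks of row vectors. *)
Lemma irreducible_commutant n (U : 'M[G]_n) (A : 'M[R[i]]_n) :
  irreducible_corep U ->
  (forall f, L1 f -> rep_of U f *m A = A *m rep_of U f) -> exists a, A = a%:M.
Proof.
move=> [n0 Uirr] UA; have [a] := eigenvalue_closed A^T n0.
move=> /eigenvalueP[v /(congr1 trmx)]; rewrite trmx_mul trmxK linearZ /= => Av v0.
have [|c u w /= uE wE|E EP] :=
    @vspace_of_linear_closed _ _ [set w : 'cV_n | A *m w = a *: w].
- by rewrite /= mulmx0 scaler0.
- by rewrite mulmxDr -scalemxAr uE wE scalerDr !scalerA mulrC.
have Einv f w : L1 f -> w \in E -> rep_of U f *m w \in E.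
  by move=> fL1 /EP /= wE; apply/EP => /=; rewrite mulmxA -UA // -mulmxA wE scalemxAr.
exists a; case: (Uirr E Einv) => E0.
  have : v^T \in E by apply/EP.
  by rewrite E0 memv0 trmx_eq0 (negPf v0).
apply/matrixP => i j.
have /EP /= /matrixP/(_ i 0) : delta_mx j 0 \in E by rewrite E0 memvf.
by rewrite -colE !mxE eqxx andbT mulr_natr.
Qed.

(** Both products of [A] with its adjoint commute with an irreducible, so they are scalars [c] and
    [d]. If [c] is nonzero then [d = c], and [A] divided by the square root of [c] is unitary. *)
Lemma irreducible_intertwiner m n (U : 'M[G]_m) (V : 'M[G]_n) (A : 'M[R[i]]_(m, n)) :
  unitary_corep U -> irreducible_corep U -> unitary_corep V -> irreducible_corep V ->
  (forall f, L1 f -> rep_of U f *m A = A *m rep_of V f) ->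
  A = 0 \/ unitarily_equivalent V U.
Proof.
move=> [UU' U'U Uc] Uirr [VV' V'V Vc] Virr intA.
have UA : U *m sc A = sc A *m V.
  apply: mx_predual_separates => f fL1.
  by rewrite (map_predual_mulr _ _ fL1) (map_predual_mull _ _ fL1); exact: intA.
(* Unitarity turns [UA] into an identity for the adjoints of [U] and [V]; applying the involution
   gives the claim. *)
have VA : V *m sc (adjmx A) = sc (adjmx A) *m U.
  have : sc A *m mx_star V = mx_star U *m sc A.
    rewrite -[LHS]mul1mx -U'U -!mulmxA; congr (_ *m _).
    by rewrite mulmxA UA -mulmxA VV' mulmx1.
  move=> /(congr1 (fun M => (map_mx star M)^T)).
  rewrite !map_star_mulmx !map_star_scalar_coef /adjmx /mx_star -!map_trmx !trmxK.
  rewrite -!map_mx_comp.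
  by rewrite !(eq_map_mx_id _ (fun x => _)) // => x /=; rewrite vn_starK.
have intA' f : L1 f -> rep_of V f *m adjmx A = adjmx A *m rep_of U f.
  move=> fL1; rewrite /rep_of -(map_predual_mulr _ _ fL1) VA.
  exact: map_predual_mull.
have [|c cE] := @irreducible_commutant _ V (adjmx A *m A) Virr.
  by move=> f fL1; rewrite mulmxA intA' // -!mulmxA intA.
have [|d dE] := @irreducible_commutant _ U (A *m adjmx A) Uirr.
  by move=> f fL1; rewrite mulmxA intA // -!mulmxA intA'.
have cS j : c = \sum_i `|A i j| ^+ 2 by rewrite -mul_adjmx_diag cE mxE eqxx.
have [c0|c0] := eqVneq c 0.
  left; apply/matrixP => i j; rewrite mxE; apply/eqP; rewrite -normr_eq0 -sqrf_eq0.
  have := esym (cS j); rewrite c0 => /psumr_eq0P -> // k _; exact: exprn_ge0.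
have c_gt0 : 0 < c.
  rewrite lt_def c0 (cS (Ordinal Virr.1)); apply: sumr_ge0 => k _; exact: exprn_ge0.
have dc : d = c.
  (* Both [d *: A] and [c *: A] equal [A *m adjmx A *m A]. *)
  have : (d - c) *: A = 0.
    rewrite scalerBl -!mul_scalar_mx -dE -mulmxA cE.
    by rewrite mul_mx_scalar mul_scalar_mx subrr.
  move=> /eqP; rewrite scaler_eq0 subr_eq0 => /predU1P[/eqP//|/eqP A0].
  move: c0; rewrite (cS (Ordinal Virr.1)) big1 ?eqxx // => k _.
  by rewrite A0 mxE normr0 expr0n.
right; have sc0 : sqrtC c != 0 by rewrite sqrtC_eq0.
have ss : (sqrtC c)^-1 * (sqrtC c)^-1 * c = 1.
  by rewrite -{3}[c]sqrtCK expr2 -invfM mulVf // mulf_neq0.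
have sconj : Num.conj (sqrtC c)^-1 = (sqrtC c)^-1.
  by rewrite geC0_conj // invr_ge0 sqrtC_ge0 ltW.
exists ((sqrtC c)^-1 *: A).
rewrite -[(map_mx _ _)^T]/(adjmx _) adjmxZ sconj; split.
- by rewrite -scalemxAl -scalemxAr scalerA dE dc scale_scalar_mx ss.
- by rewrite -scalemxAl -scalemxAr scalerA cE scale_scalar_mx ss.
- by move=> f fL1; rewrite -scalemxAl -scalemxAr intA.
Qed.

End Schur.

(** * Convolution with Fourier transforms of coefficients *)

Section Convolution.
Variables (R : realType) (G : compactQuantumGroup R).

(** With [Phi] the tensor product of the Haar state and [g], expand the first-leg copy of [U i j] as
    a sum of second-leg copies of [B j k] times [coproduct G (U i k)]. Haar invariance then
    evaluates each term at [U i k * x]. *)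
Lemma convolution_hat n (U B : 'M[G]_n) (g : G -> R[i]) i j :
  corep U -> B *m U^T = 1%:M -> L1 g ->
  convolution (hat (U i j)) g (fun x => \sum_k g (B j k) * hat (U i k) x).
Proof.
move=> Uc BU gL1.
have [Phi [PhiL1 PhiE]] := tensor_functional_ex (Linfty2 G) (haar_normal G) gL1.
exists (fun z => Phi (vt_inl (Linfty2 G) (U i j) * z)); split.
  split=> [|a b]; first exact: predual_mull.
  by rewrite vt_tensM mul1r PhiE.
(* This substitutes for strong invariance, without the antipode. *)
move=> x; have -> : vt_inl (Linfty2 G) (U i j) =
    \sum_k vt_inr (Linfty2 G) (B j k) * coproduct G (U i k).
  under eq_bigr do rewrite Uc mulr_sumr.
  rewrite exchange_big /=; under eq_bigr => t _.
    under eq_bigr do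
      rewrite vt_tens_inlr mulrA -vt_tens_inrl vt_tens_inlr -mulrA -rmorphM.
    rewrite -mulr_sumr -raddf_sum /=.
    have -> : \sum_k B j k * U t k = (j == t)%:R.
      have /matrixP/(_ j t) := BU; rewrite !mxE => <-.
      by apply: eq_bigr => k _; rewrite mxE.
    over.
  rewrite (bigD1 j) //= eqxx rmorph1 mulr1 big1 ?addr0 // => t tj.
  by rewrite eq_sym (negPf tj) rmorph0 mulr0.
rewrite mulr_suml predual_sum //; apply: eq_bigr => k _.
rewrite -mulrA -rmorphM.
have FL : predual (fun b => g (B j k * b)) by exact: predual_mull.
have FT : tensor_functional (@haar _ G) (fun b => g (B j k * b))
    (fun z => Phi (vt_inr (Linfty2 G) (B j k) * z)).
  split=> [|a b]; first exact: predual_mull.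
  by rewrite vt_tensM mul1r PhiE.
by rewrite (haar_right FL FT) mulr1.
Qed.

End Convolution.

Section Orthogonality.
Variables (R : realType) (G : compactQuantumGroup R) (Irr : irrFamily G).
Variables (p : Irr) (B : 'M[G]_(irr_dim p)).
Local Notation h := (@haar R G).
Local Notation star := (@vn_star R G).
Local Notation sc := (scalar_coef G).
Local Notation U := (irr_coef p).
Hypotheses (Bc : corep B) (BU : B *m U^T = 1%:M).

(** Multiplying [haar_corep_l] by [U^T] on the right cancels [B] and leaves an intertwining
    relation. *)
Let gram_intertwines (q : Irr) i j f : L1 f ->
  let Z := \matrix_(a, b) h (irr_coef q i a * B j b) in
  rep_of U f *m Z^T = Z^T *m rep_of (irr_coef q) f.
Proof.
move=> fL1 Z; have [_ _ qc] := irr_unitary q.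
have : sc Z *m U^T = (irr_coef q)^T *m sc Z.
  by rewrite -[in LHS](haar_corep_l qc Bc i j) -(mulmxA _ B) BU mulmx1.
move=> /(congr1 (map_mx f)).
rewrite (map_predual_mull _ _ fL1) (map_predual_mulr _ _ fL1).
by move=> /(congr1 trmx); rewrite !trmx_mul -!map_trmx !trmxK.
Qed.

Lemma haar_orthogonal (q : Irr) i l j t : q <> p -> h (irr_coef q i l * B j t) = 0.
Proof.
move=> qp; pose Z := \matrix_(a, b) h (irr_coef q i a * B j b).
have [Z0|/irr_distinct//] := irreducible_intertwiner (irr_unitary p)
  (irr_irreducible p) (irr_unitary q) (irr_irreducible q)
  (fun f fL1 => gram_intertwines i j fL1).
by have /matrixP/(_ t l) := Z0; rewrite !mxE.
Qed.

Lemma haar_diagonal i j : exists a, forall l t, h (U i l * B j t) = a *+ (l == t).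
Proof.
have [a Za] := irreducible_commutant (irr_irreducible p)
  (fun f fL1 => gram_intertwines i j fL1).
by exists a => l t; have /matrixP/(_ t l) := Za; rewrite !mxE eq_sym.
Qed.

(** The entries [y] of [sc d *m U] pair to zero with [B], hence with [Ubar] and with [star y].
    Faithfulness gives [y = 0], and [U] is invertible. *)
Lemma haar_pairing_nondegenerate
    (Q : 'M[R[i]]_(irr_dim p)) (d : 'rV[R[i]]_(irr_dim p)) :
  Q \in unitmx -> B = sc Q *m map_mx star U *m sc (invmx Q) ->
  (forall l j t, \sum_i d 0 i * h (U i l * B j t) = 0) -> d = 0.
Proof.
move=> Qunit BE dB; apply: (@scalar_coef_eq0 _ G).
have [UU' _ _] := irr_unitary p; rewrite -[LHS]mulmx1 -UU' mulmxA.
suff -> : sc d *m U = 0 by rewrite mul0mx.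
apply/matrixP => i l; rewrite ord1 [RHS]mxE; set y := (sc d *m U) 0 l.
have yE : y = \sum_i d 0 i *: U i l.
  by rewrite /y mxE; apply: eq_bigr => k _; rewrite mxE mulr_algl.
have yL1 : predual (fun x => h (y * x)) by exact: predual_mull (haar_normal G).
have yB : map_mx (fun x => h (y * x)) B = 0.
  apply/matrixP => j t; rewrite !mxE -(dB l j t) yE mulr_suml haar_sum.
  by apply: eq_bigr => k _; rewrite -scalerAl haarZ.
have yUbar : map_mx (fun x => h (y * x)) (map_mx star U) = 0.
  move: yB; rewrite BE (map_predual_mulr _ _ yL1) (map_predual_mull _ _ yL1).
  move=> /(congr1 (mulmx^~ Q)); rewrite mulmxKV // mul0mx.
  by move=> /(congr1 (mulmx (invmx Q))); rewrite mulKmx // mulmx0.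
apply: haar_mulstar_eq0; rewrite {2}yE vn_star_sum mulr_sumr haar_sum big1 // => k _.
rewrite vn_starZ -scalerAr haarZ.
by have /matrixP/(_ k l) := yUbar; rewrite !mxE => ->; rewrite mulr0.
Qed.

End Orthogonality.

Section Polynomials.
Variables (R : realType) (G : compactQuantumGroup R) (Irr : irrFamily G).

(** Repeated coefficients are collected into one matrix per class, so that orthogonality can isolate
    a class. [{classic Irr}] supplies the equality test that [uniq] requires. *)
Lemma Pol_coefficients (x : G) : Pol Irr x ->
  exists (ps : seq {classic Irr}) (C : forall p : Irr, 'M[R[i]]_(irr_dim p)),
    uniq ps /\
    x = \sum_(p <- ps) \sum_i \sum_j C p i j *: irr_coef (p : Irr) i j.
Proof.
move=> [s ->].
pose T_ (p : {classic Irr}) := ('I_(irr_dim (p : Irr)) * 'I_(irr_dim (p : Irr)))%type.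
have tagI (q : {classic Irr}) (u v : T_ q) : existT T_ q u = existT T_ q v -> u = v.
  by move=> /(congr1 (tagged_as (existT T_ q u))); rewrite !tagged_asE.
pose T := {p : Irr & 'I_(irr_dim p) * 'I_(irr_dim p)}%type.
pose C (p : Irr) : 'M[R[i]]_(irr_dim p) := \matrix_(i, j)
  \sum_(a <- s) (if `[< a.2 = existT _ p (i, j) :> T >] then a.1 else 0).
exists (undup [seq tag a.2 : {classic Irr} | a <- s]), C.
split; first exact: undup_uniq.
set ps := undup _.
transitivity (\sum_(p <- ps) \sum_i \sum_j \sum_(a <- s)
    (if `[< a.2 = existT _ (p : Irr) (i, j) :> T >] then a.1 else 0) *:
      irr_coef (p : Irr) i j); last first.
  apply: eq_bigr => p _; apply: eq_bigr => i _; apply: eq_bigr => j _.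
  by rewrite mxE scaler_suml.
symmetry; under eq_bigr do under eq_bigr do rewrite exchange_big.
under eq_bigr do rewrite exchange_big.
rewrite exchange_big /=.
apply: (@eq_big_seq _ _ _ {classic (R[i] * T)} s) => -[c [q [k l]]] aS /=.
have qps : (q : {classic Irr}) \in ps.
  by rewrite mem_undup; apply/(@mapP {classic (R[i] * T)} {classic Irr});
    exists (c, existT _ q (k, l)).
(* For a fixed term of [s], only its own class and its own pair of indices contribute. *)
rewrite (bigD1_seq (q : {classic Irr}) qps (undup_uniq _)) /= [X in _ + X]big1 ?addr0.
  have other i j : (k, l) <> (i, j) ->
      (if `[< existT _ q (k, l) = existT _ q (i, j) :> T >] then c else 0) *:
        irr_coef q i j = 0.
    by move=> ne; case: asboolP => [/(tagI q)//|_]; rewrite scale0r.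
  rewrite (bigD1 k) //= (bigD1 l) //= asboolT //.
  rewrite big1 => [|j jl]; last by rewrite other // => -[E]; rewrite E eqxx in jl.
  rewrite big1 => [|i ik]; first by rewrite !addr0.
  by rewrite big1 // => j _; rewrite other // => -[E]; rewrite E eqxx in ik.
move=> p pq; rewrite big1 // => i _; rewrite big1 // => j _.
case: asboolP => [/(congr1 tag) /= qp|_]; last by rewrite scale0r.
by rewrite qp eqxx in pq.
Qed.

End Polynomials.

(** * Left ideals *)

Section LeftIdeal.
Variables (R : realType) (G : compactQuantumGroup R) (Irr : irrFamily G).
Variables (I : set (G -> R[i])) (HI : left_ideal I).
Local Notation h := (@haar R G).
Local Notation star := (@vn_star R G).
Local Notation sc := (scalar_coef G).

Lemma left_ideal_sum (J : eqType) (r : seq J) (F : J -> G -> R[i]) :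
  (forall j, j \in r -> I (F j)) -> I (fun x => \sum_(j <- r) F j x).
Proof.
case: HI => _ I0 IL _; elim: r => [|j r IHr] IF.
  by under eq_fun do rewrite big_nil.
under eq_fun do rewrite big_cons -[F j _]mul1r.
apply: IL; first by apply: IF; rewrite mem_head.
by apply: IHr => k kr; apply: IF; rewrite inE kr orbT.
Qed.

Lemma hat_sum (J : Type) (r : seq J) (F : J -> G) :
  hat (\sum_(j <- r) F j) = fun x => \sum_(j <- r) hat (F j) x.
Proof. by apply/funext => x; rewrite /hat mulr_suml haar_sum. Qed.

Lemma hatZ c (y : G) x : hat (c *: y) x = c * hat y x.
Proof. by rewrite /hat -scalerAl haarZ. Qed.

Lemma L1_hat (y : G) : L1 (hat y).
Proof. exact: predual_mull (haar_normal G). Qed.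

Lemma common_kernel_hull : exists E : hull Irr, forall p v,
  v \in E p <-> forall g, I g -> rep_of (irr_coef p) g *m v = 0.
Proof.
have kerE (p : Irr) : exists W : {vspace 'cV[R[i]]_(irr_dim p)}, forall v,
    v \in W <-> forall g, I g -> rep_of (irr_coef p) g *m v = 0.
  apply: vspace_of_linear_closed => [g _|c u v uK vK g Ig]; first by rewrite mulmx0.
  by rewrite mulmxDr -scalemxAr uK // vK // scaler0 addr0.
by exists (fun p => sval (cid (kerE p))) => p; exact: (svalP (cid (kerE p))).
Qed.

Variable E : hull Irr.
Hypothesis EP : forall p v,
  v \in E p <-> forall g, I g -> rep_of (irr_coef p) g *m v = 0.

(** Treats one class of a polynomial at a time. Here [f] stands for the transform of the whole
    polynomial, because membership in [hull_I E] is known for it and not for its blocks; the second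
    hypothesis says that [B] sees only the block [C]. *)
Lemma left_ideal_block (p : Irr) (C : 'M[R[i]]_(irr_dim p)) (f : G -> R[i]) :
  hull_I E f ->
  (forall B : 'M[G]_(irr_dim p), corep B -> B *m (irr_coef p)^T = 1%:M ->
    forall j t, f (B j t) = \sum_i \sum_l C i l * h (irr_coef p i l * B j t)) ->
  I (hat (\sum_i \sum_j C i j *: irr_coef p i j)).
Proof.
move=> [fL1 fE] fC; have Uunit := irr_unitary p; have Uirr := irr_irreducible p.
set U := irr_coef p in Uunit Uirr fC *.
have [_ _ Uc] := Uunit.
have [q [X [[Y YX] XU]]] := conj_corep_equiv Irr Uunit Uirr.
have Qunit := haar_gram_unit Uunit; set Q := haar_gram U in Qunit.
pose B := sc Q *m map_mx star U *m sc (invmx Q).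
have Bc : corep B by apply: corep_conj; [exact: mulVmx|exact: corep_star].
have BU : B *m U^T = 1%:M.
  have QU := conj_corep_inverse Uunit.
  rewrite -[LHS]mulmx1 -[1%:M](map_mx1 (GRing.in_alg G)) -(mulmxV Qunit) map_mxM.
  rewrite /B mulmxA -!(mulmxA (sc Q)) QU mul1mx -map_mxM mulmxV //; exact: map_mx1.
have gB g : L1 g -> map_mx g B = Q *m map_mx g (map_mx star U) *m invmx Q.
  by move=> gL1; rewrite -(map_predual_mull Q _ gL1); exact: map_predual_mulr.
have BE : B = sc Q *m map_mx star U *m sc (invmx Q) by [].
clearbody B; pose S : set 'rV[R[i]]_(irr_dim p) :=
  [set w | forall i, I (fun x => \sum_t w 0 t * hat (U i t) x)].
have [IL1 I0 IL Iconv] := HI.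
have rowS i : S (row i C).
  apply: linear_closed_annihilator => [k|c u w uS wS k|v vS].
  - under eq_fun do under eq_bigr do rewrite mxE mul0r.
    by under eq_fun do rewrite big1_eq.
  - under eq_fun do under eq_bigr do rewrite !mxE mulrDl -mulrA.
    by under eq_fun do rewrite big_split /= -mulr_sumr; exact: IL.
  (* By [convolution_hat] and the ideal property, the rows of [map_mx g B] lie in [S]. *)
  have gBv g : I g -> map_mx g B *m v = 0.
    move=> Ig; apply/row_matrixP => j; rewrite row_mul row0; apply: vS => k.
    under eq_fun do under eq_bigr do rewrite !mxE.
    exact: (Iconv _ _ _ (L1_hat _) Ig (convolution_hat k j Uc BU (IL1 _ Ig))).
  have fBv : map_mx f B *m v = 0.
    (* [B] is similar to the representation [q], so the hull condition is used at [q], the conjugate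
       of [p], rather than at [p]. *)
    have XwE : X *m (invmx Q *m v) \in E q.
      apply/EP => g Ig; rewrite mulmxA -(XU _ (IL1 _ Ig)) -mulmxA.
      have /(congr1 (mulmx (invmx Q))) := gBv g Ig.
      rewrite (gB _ (IL1 _ Ig)) -!mulmxA mulKmx // mulmx0 => ->.
      by rewrite mulmx0.
    have := fE _ _ XwE; rewrite mulmxA -(XU _ fL1) -mulmxA.
    move=> /(congr1 (mulmx Y)); rewrite mulmxA YX mul1mx mulmx0 => fw.
    by rewrite (gB _ fL1) -!mulmxA fw mulmx0.
  (* The pairing is diagonal in [l] and [t], so entry [j] of [map_mx f B *m v] is the sum over [k]
     of [(C *m v) k 0 * a (k, j)]. *)
  have [a aE] := choice (fun ij => haar_diagonal Bc BU ij.1 ij.2).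
  have d0 : (C *m v)^T = 0.
    apply: (haar_pairing_nondegenerate Qunit BE) => l j t.
    under eq_bigr => k _ do rewrite (aE (k, j)) mulrnAr.
    rewrite sumrMnl; apply/eqP; rewrite mulrn_eq0; apply/orP; right; apply/eqP.
    transitivity ((map_mx f B *m v) j 0); last by rewrite fBv mxE.
    rewrite [RHS]mxE; under eq_bigr do rewrite !mxE mulr_suml.
    rewrite exchange_big /=; apply: eq_bigr => s _.
    rewrite mxE (fC _ Bc BU) mulr_suml; apply: eq_bigr => k _.
    rewrite (bigD1 s) //= (aE (k, j)) eqxx mulr1n big1 ?addr0 => [|m ms].
      by rewrite mulrAC.
    by rewrite (aE (k, j)) (negPf ms) mulr0n mulr0.
  by rewrite -row_mul -[C *m v]trmxK d0 trmx0 row0.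
rewrite hat_sum; apply: left_ideal_sum => i _.
have := rowS i i; congr I; apply/funext => x; rewrite hat_sum.
by apply: eq_bigr => t _; rewrite hatZ mxE.
Qed.

End LeftIdeal.

Theorem proposition3p4 (R : realType) (G : compactQuantumGroup R)
    (Irr : irrFamily G) (I : set (G -> R[i])) (HI : left_ideal I) :
  exists E : hull Irr, hull_j E `<=` I /\ I `<=` hull_I E.
Proof.
have [E EP] := common_kernel_hull Irr I; exists E; split=> [f [fE [x xPol fx]]|g Ig].
  have [ps [C [ps_uniq xE]]] := Pol_coefficients xPol.
  rewrite -{f}fx xE hat_sum in fE *; apply: (left_ideal_sum HI) => p pps.
  apply: (left_ideal_block HI EP fE) => B Bc BU j t.
  (* The classes other than [p] integrate to zero against [B]. *)
  rewrite (bigD1_seq p pps ps_uniq) /= [X in _ + X]big1 ?addr0 => [|q qp].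
    rewrite hat_sum; apply: eq_bigr => i _; rewrite hat_sum; apply: eq_bigr => l _.
    exact: hatZ.
  rewrite hat_sum big1 // => i _; rewrite hat_sum big1 // => l _.
  by rewrite hatZ /hat (haar_orthogonal Bc BU) ?mulr0 //; exact: (elimN eqP qp).
have [IL1 _ _ _] := HI; split=> [|p v vE]; first exact: IL1.
exact: (EP p v).1.
Qed.
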